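(* Let $\boldsymbol\mu=\{\mu_t\}_{t>0}$ be a measurable factorizing family over $[0,1]\times L$, with countable ring $\mathcal R\subset\Sigma_1$ as in condition (iv a), and let $\mathbb E^{\boldsymbol\mu}$ be its random-set system. Then $\mathbb E^{\boldsymbol\mu}$ is spatial if and only if there exists a family $\boldsymbol\nu=\{\nu_t\}_{t>0}$ of probability measures on $(\mathscr C_t,\Sigma_t)$ such that (i) $\nu_t\ll\mu_t$ for all $t>0$; (ii) $\nu_{s+t}=(\nu_s\otimes\nu_t)\circ\oplus_{s,t}^{-1}$ for all $s,t>0$; (iii) $t\mapsto(\sigma_t)_*\nu_t(A)$ is Borel on $(0,\infty)$ for every $A\in\mathcal R$.
   Context: Let $L$ be a locally compact, second countable Hausdorff space. For $t>0$ let $\mathscr C_t$ be the space of closed subsets of $[0,t]\times L$ with the Borel $\sigma$-field $\Sigma_t$ of the Fell topology. $\oplus_{s,t}(Z_1,Z_2)=Z_1\cup(s+Z_2)$ with $s+Z_2=\{(s+r,\ell):(r,\ell)\in Z_2\}$; $\sigma_t(Z)=\{(r/t,\ell):(r,\ell)\in Z\}\in\mathscr C_1$. A family of probability measures $\{\mu_t\}$ on $\mathscr C_t$ is a measurable factorizing family over $[0,1]\times L$ if: (i) $\mu_{s+t}\sim(\mu_s\otimes\mu_t)\circ\oplus_{s,t}^{-1}$ (mutual absolute continuity); (ii) $\mu_t(\{Z:Z\cap(\{r\}\times L)\neq\varnothing\})=0$ for all $t>0,r\in[0,t]$; (iii) no $\mu_t$ is supported on finitely many atoms; (iv a) there is a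 countable ring $\mathcal R\subset\Sigma_1$ generating $\Sigma_1$ with $t\mapsto(\sigma_t)_*\mu_t(A)$ Borel for each $A\in\mathcal R$; (iv b) there is a Borel $\Delta:(0,\infty)^2\times\mathscr C_1\to(0,\infty)$ with $\Delta(s,t,\sigma_{s+t}(Z))=\Delta_{s,t}(Z)$ $\mu_{s+t}$-a.e., where $\Delta_{s,t}=d((\mu_s\otimes\mu_t)\circ\oplus_{s,t}^{-1})/d\mu_{s+t}$. The random-set system $\mathbb E^{\boldsymbol\mu}$: $E_t=L^2(\mathscr C_t,\mu_t)$, $U_{s,t}(f\otimes g)(Z)=\Delta_{s,t}(Z)^{1/2}f(Z\cap([0,s]\times L))\,g((Z\cap([s,s+t]\times L))-(s,0))$, with the Borel structure transported via $f\mapsto f\circ\sigma_t^{-1}$ from the measurable field $\{L^2(\mathscr C_1,(\sigma_t)_*\mu_t)\}$ whose measurable structure is generated by the fundamental sections $t\mapsto\mathbf 1_A$, $A\in\mathcal R$; it is an Arveson system. A unit is a nonzero Borel section $t\mapsto u_t\in E_t$ with $u_{s+t}=U_{s,t}(u_s\otimes u_t)$ for all $s,t>0$; the system is spatial if it has a unit. *)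

(* Defs.v *)
From HB Require Import structures.
From mathcomp Require Import all_boot all_order all_algebra.
From mathcomp Require Import all_classical all_reals all_analysis measurable_realfun.
From mathcomp Require Import complex.
Unset Printing Implicit Defensive.
Import Order.TTheory GRing.Theory Num.Theory.
Import numFieldNormedType.Exports.
Local Open Scope classical_set_scope.
Local Open Scope ring_scope.

Definition Xt {R : realType} {L : topologicalType} (t : R) : set (R * L) :=
  `[0, t] `*` [set: L].

(* closed subsets of [0,t] x L (closed in the subspace [0,t] x L, which is
   the same as closed in R x L and contained in [0,t] x L) *)
Definition CtT {R : realType} {L : topologicalType} (t : R) :=
  {Z : set (R * L) | closed Z /\ Z `<=` @Xt R L t}.

Lemma CtT0_proof {R : realType} {L : topologicalType} (t : R) :
  closed (set0 : set (R * L)) /\ set0 `<=` @Xt R L t.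
Proof. by split; [exact: closed0 | exact: sub0set]. Qed.

Definition CtT0 {R : realType} {L : topologicalType} (t : R) : @CtT R L t :=
  exist _ set0 (CtT0_proof t).

HB.instance Definition _ (R : realType) (L : topologicalType) (t : R) :=
  gen_eqMixin (@CtT R L t).
HB.instance Definition _ (R : realType) (L : topologicalType) (t : R) :=
  gen_choiceMixin (@CtT R L t).
HB.instance Definition _ (R : realType) (L : topologicalType) (t : R) :=
  isPointed.Build (@CtT R L t) (CtT0 t).

(* Subbase of the Fell topology on C_t:
     {Z | Z cap K = empty}, K compact subset of [0,t] x L,
     {Z | Z cap G <> empty}, G open in [0,t] x L (i.e. G' cap ([0,t] x L) with
     G' open in R x L; since Z is contained in [0,t] x L, Z meets G' cap X_t
     iff Z meets G'). *)
Definition fell_subbase {R : realType} {L : topologicalType} (t : R) :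
    set (set (@CtT R L t)) :=
  [set S | (exists K : set (R * L), [/\ compact K, K `<=` @Xt R L t &
                S = [set Z | proj1_sig Z `&` K = set0]])
        \/ (exists G : set (R * L), open G /\
                S = [set Z | proj1_sig Z `&` G !=set0])].

Definition fell_open {R : realType} {L : topologicalType} (t : R) :
    set (set (@CtT R L t)) :=
  [set O | forall Z, O Z -> exists s : seq (set (@CtT R L t)),
      [/\ (forall S, S \in s -> fell_subbase t S),
          (foldr setI setT s) Z & foldr setI setT s `<=` O]].

Definition Ct {R : realType} {L : topologicalType} (t : R) :=
  g_sigma_algebraType (@fell_open R L t).

(* casting a subset of R x L into C_t (all uses below produce genuine
   closed subsets of [0,t] x L; the default branch is never used for t > 0) *)
Definition mkC {R : realType} {L : topologicalType} (t : R) (Z : set (R * L))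
  : @Ct R L t :=
  match pselect (closed Z /\ Z `<=` @Xt R L t) with
  | left h => exist _ Z h
  | right _ => CtT0 t
  end.

Definition shift {R : realType} {L : Type} (s : R) (Z : set (R * L)) :
  set (R * L) := (fun x => (s + x.1, x.2)) @` Z.

Definition oplus {R : realType} {L : topologicalType} (s t : R)
  (p : @Ct R L s * @Ct R L t) : @Ct R L (s + t) :=
  mkC (s + t) (proj1_sig p.1 `|` shift s (proj1_sig p.2)).

Definition sigmat {R : realType} {L : topologicalType} (t : R)
  (Z : @Ct R L t) : @Ct R L 1 :=
  mkC 1 ((fun x => (x.1 / t, x.2)) @` proj1_sig Z).

Definition lpart {R : realType} {L : topologicalType} (s t : R)
  (Z : @Ct R L (s + t)) : @Ct R L s :=
  mkC s (proj1_sig Z `&` (`[0, s] `*` [set: L])).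

Definition rpart {R : realType} {L : topologicalType} (s t : R)
  (Z : @Ct R L (s + t)) : @Ct R L t :=
  mkC t (shift (- s) (proj1_sig Z `&` (`[s, s + t] `*` [set: L]))).

(* A measurable factorizing family mu over [0,1] x L, with the countable ring
   Rr of condition (iv a) and the Borel function Delta of condition (iv b).
   Delta s t (sigma_{s+t} Z) is required to be (a version of) the
   Radon-Nikodym derivative Delta_{s,t} of (mu_s x mu_t) o oplus^{-1} with
   respect to mu_{s+t}. *)
Definition measurable_factorizing_family {R : realType} {L : topologicalType}
  (mu : forall t : R, probability (@Ct R L t) R)
  (Rr : set (set (@Ct R L 1)))
  (Delta : R -> R -> @Ct R L 1 -> R) : Prop :=
  [/\
      (forall s t : R, 0 < s -> 0 < t ->
         pushforward (mu s \x mu t)%E (@oplus R L s t) `<< mu (s + t) /\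
         mu (s + t) `<< pushforward (mu s \x mu t)%E (@oplus R L s t)),
      (forall t r : R, 0 < t -> 0 <= r <= t ->
         mu t [set Z : @Ct R L t | exists l : L, proj1_sig Z (r, l)] = 0%E),
      (forall t : R, 0 < t ->
         ~ exists A : set (@Ct R L t),
             [/\ finite_set A, measurable A & mu t A = 1%E]),
      [/\ countable Rr, setring Rr, Rr `<=` measurable,
          <<s Rr >> = (@measurable _ (@Ct R L 1)) &
          (forall A, Rr A ->
             measurable_fun (`]0, +oo[%classic : set R)
               (fun t : R => pushforward (mu t) (@sigmat R L t) A))] &
      [/\ measurable_fun
            (((`]0, +oo[%classic : set R) `*` (`]0, +oo[%classic : set R)) `*` [set: @Ct R L 1])
            (fun p : (R * R) * @Ct R L 1 => Delta p.1.1 p.1.2 p.2),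
          (forall s t Z, 0 < s -> 0 < t -> 0 < Delta s t Z) &
          (forall s t : R, 0 < s -> 0 < t ->
           forall A : set (@Ct R L (s + t)), measurable A ->
             pushforward (mu s \x mu t)%E (@oplus R L s t) A =
             (\int[mu (s + t)%R]_(Z in A)
                 (Delta s t (@sigmat R L (s + t)%R Z))%:E)%E)]].

(* A unit of E^mu: for each t > 0 a vector u_t of L^2(C_t, mu_t; C),
   represented by a square-integrable Borel function C_t -> C (vectors of
   L^2 are identified when equal mu_t-a.e.), such that
   * (Borel section) for each fundamental section 1_A, A in Rr, the
     coefficient t |-> < 1_A , u_t o sigma_t^{-1} >_{L^2((sigma_t)_* mu_t)}
       = \int_{C_t} 1_A(sigma_t Z) u_t(Z) dmu_t(Z)
     is Borel on (0,oo) (real and imaginary parts);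
   * the section is nonzero;
   * u_{s+t} = U_{s,t}(u_s (x) u_t), i.e. mu_{s+t}-a.e.
       u_{s+t}(Z) = Delta_{s,t}(Z)^{1/2} u_s(Z cap [0,s] x L)
                      u_t((Z cap [s,s+t] x L) - (s,0)). *)
Definition is_unit {R : realType} {L : topologicalType}
  (mu : forall t : R, probability (@Ct R L t) R)
  (Rr : set (set (@Ct R L 1)))
  (Delta : R -> R -> @Ct R L 1 -> R)
  (u : forall t : R, @Ct R L t -> R[i]) : Prop :=
  [/\ (forall t : R, 0 < t ->
         [/\ measurable_fun setT (fun Z => complex.Re (u t Z)),
             measurable_fun setT (fun Z => complex.Im (u t Z)) &
             (mu t).-integrable setT
               (fun Z => ((complex.Re (u t Z)) ^+ 2
                          + (complex.Im (u t Z)) ^+ 2)%:E)]),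
      (forall A, Rr A ->
         measurable_fun (`]0, +oo[%classic : set R)
           (fun t : R => (\int[mu t]_(Z in @sigmat R L t @^-1` A)
                            (complex.Re (u t Z))%:E)%E) /\
         measurable_fun (`]0, +oo[%classic : set R)
           (fun t : R => (\int[mu t]_(Z in @sigmat R L t @^-1` A)
                            (complex.Im (u t Z))%:E)%E)),
      (exists2 t : R, 0 < t & ~ {ae mu t, forall Z, u t Z = 0}) &
      (forall s t : R, 0 < s -> 0 < t ->
         {ae mu (s + t), forall Z,
            u (s + t) Z =
              ((Num.sqrt (Delta s t (@sigmat R L (s + t) Z)))%:C)%C
              * u s (@lpart R L s t Z) * u t (@rpart R L s t Z)})].

Definition spatial {R : realType} {L : topologicalType}
  (mu : forall t : R, probability (@Ct R L t) R)
  (Rr : set (set (@Ct R L 1)))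
  (Delta : R -> R -> @Ct R L 1 -> R) : Prop :=
  exists u : forall t : R, @Ct R L t -> R[i], is_unit mu Rr Delta u.

(* Main.v *)
(* From a family [nu] one gets the unit [u_t = sqrt (d nu_t / d mu_t)]; from a
   unit one gets [nu_t = |u_t|^2 mu_t / |u_t|^2_{L^2}]. Both multiplicativity
   statements come from one change of variables: [oplus] is inverted by the pair
   (left part, right part) almost everywhere because slices are null, so
   integrating [f(left) g(right) Delta] against [mu_{s+t}] amounts to integrating
   [f g] against [mu_s x mu_t].

   The Borel dependence on [t] is obtained on [C_1] without jointly measurable
   versions. Finite rational combinations of indicators of sets of the countable
   ring are dense in every L^2(A, m_t), so the integral of [f_t^2] over [A] is a
   countable supremum of Borel functions of [t] as soon as the integrals of [f_t]
   over sets of the ring are Borel. Square roots follow by an iteration using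
   only squares; to apply it to [sqrt h] with [h = d nu / d mu] unbounded, change
   the reference measure to [m = mu + nu] and write
   [sqrt h dmu = sqrt (k (1 - k)) dm] with [k = h / (1 + h)].

   The norm of a unit is Borel if the ring exhausts [C_1] up to null sets, which
   may only fail when some [mu_t] charges the empty set; in that case all of them
   do, and the Dirac masses at the empty set form a factorizing family. *)

Require Import Defs.
From HB Require Import structures.
From mathcomp Require Import all_boot all_order all_algebra.
From mathcomp Require Import all_classical all_reals all_analysis measurable_realfun.
From mathcomp Require Import complex ring lra.
Import Order.TTheory GRing.Theory Num.Theory.
Import numFieldNormedType.Exports.
Local Open Scope classical_set_scope.
Local Open Scope ring_scope.

(** * The Fell Borel structure *)

(** The class of sets whose avoidance is shown to be a measurable condition: avoiding a countable
    union is a countable intersection of such conditions, and all open and all closed subsets of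
    [R * L] turn out to be of this kind. *)
Definition sigma_compact {T : topologicalType} (F : set T) :=
  exists2 K : nat -> set T, (forall n, compact (K n)) & F = \bigcup_n K n.

Lemma compact_sigma_compact {T : topologicalType} (F : set T) :
  compact F -> sigma_compact F.
Proof. by move=> cF; exists (fun=> F) => //; rewrite bigcup_const//; exists 0%N. Qed.

Lemma sigma_compact_closedI {T : topologicalType} (F C : set T) :
  sigma_compact F -> closed C -> sigma_compact (F `&` C).
Proof.
move=> [K cK ->] cC; exists (fun n => K n `&` C).
  by move=> n; exact: compact_closedI.
by rewrite setI_bigcupl.
Qed.

Lemma sigma_compact_countable {T : topologicalType} {I : countType} (P : set I)
    (K : I -> set T) : (forall i, compact (K i)) ->
  sigma_compact (\bigcup_(i in P) K i).
Proof.
move=> cK.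
(* Codes of no index, and codes of indices outside [P], contribute the empty compact set. *)
exists (fun n => if unpickle n is Some i then if `[< P i >] then K i else set0
                 else set0).
  move=> n; case: (unpickle n) => [i|]; last exact: compact0.
  by case: ifP => _; [exact: cK|exact: compact0].
apply/seteqP; split=> [x [i Pi Kx]|x [n _]].
  by exists (pickle i) => //=; rewrite pickleK; case: asboolP.
by case: (unpickle n) => [i|//]; case: asboolP => // Pi Kx; exists i.
Qed.

(** * A countable base of compact neighbourhoods in [R * L] *)

Section compact_base.
Context {R : realType} {L : topologicalType}.
Hypothesis L_hausdorff : hausdorff_space L.
Hypothesis L_locally_compact : locally_compact [set: L].
Hypothesis L_second_countable : @second_countable L.

(** The sets are products of a rational segment with the closure of a relatively compact basic open
    set of [L]. That these are small enough comes from the regularity of locally compact Hausdorff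
    spaces. *)
Lemma exists_compact_base : exists K : (rat * rat) * nat -> set (R * L),
  (forall j, compact (K j)) /\
  (forall G x, open G -> G x -> exists2 j, K j `<=` G & (K j)° x).
Proof.
have [B cB [oB bB]] := L_second_countable.
have [f finj] := countable_injP _ cB.
pose e n : set L := [set l | exists b, [/\ B b, f b = n & b l]].
have eE b : B b -> e (f b) = b.
  move=> Bb; apply/seteqP; split=> [l [b' [Bb' ff b'l]]|l bl]; last by exists b.
  by rewrite -(finj b' b) ?inE.
pose K (j : (rat * rat) * nat) : set (R * L) :=
  if `[< compact (closure (e j.2)) >]
  then `[ratr j.1.1, ratr j.1.2]%classic `*` closure (e j.2) else set0.
exists K; split.
  move=> j; rewrite /K; case: asboolP => h; last exact: compact0.
  by apply: compact_setX => //; exact: segment_compact.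
move=> G [r l] oG Grl.
have : nbhs (r, l) G by exact: open_nbhs_nbhs.
move=> [[U V] /= [nU nV] UV].
have [a [b [/andP[ar rb] abU]]] : exists a b : rat,
    ratr a < r < ratr b /\ `[ratr a, ratr b]%classic `<=` U.
  have [eps /= eps0 epsU] := nU.
  have [a] := @rat_in_itvoo R (r - eps) r ltac:(lra).
  have [b] := @rat_in_itvoo R r (r + eps) ltac:(lra).
  rewrite !in_itv/= => /andP[b1 b2] /andP[a1 a2]; exists a, b; rewrite a2 b1; split=> //.
  move=> z /=; rewrite in_itv/= => /andP[z1 z2]; apply: epsU => /=.
  by rewrite ltr_norml; apply/andP; split; lra.
have [C Cl [cC clC]] := L_locally_compact l I.
rewrite withinET in Cl.
(* A neighbourhood whose closure lies in [V] and in the compact set [C]: the first inclusion keeps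
   the product inside [G], the second makes the closure of a basic set inside [W] compact. *)
have [W Wl WV] := compact_regular L_hausdorff cC Cl (filterI nV Cl).
have [b' [Bb' b'l] b'W] := bB l W Wl.
have cW : compact (closure b').
  apply: (subclosed_compact (@closed_closure _ _) cC).
  by move=> z /(closureS b'W) /WV [].
exists ((a, b), f b').
  rewrite /K /= eE//; case: asboolP => // _ [z w] [/= zab] /(closureS b'W) /WV [Vw _].
  by apply: UV; split => //=; apply: abU.
rewrite /K /= eE//; case: asboolP => // _.
exists (`]ratr a, ratr b[%classic, b') => /=.
  split; last by apply: open_nbhs_nbhs; split => //; exact: oB.
  by apply: open_nbhs_nbhs; split; [exact: interval_open|rewrite /= in_itv/= ar rb].
move=> [z w] /= [zab b'w]; split; last exact: subset_closure.
exact: subset_itv_oo_cc.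
Qed.

Lemma open_sigma_compact (G : set (R * L)) : open G -> sigma_compact G.
Proof.
have [K [cK bK]] := exists_compact_base.
move=> oG; rewrite (_ : G = \bigcup_(j in [set j | K j `<=` G]) K j).
  exact: sigma_compact_countable.
apply/seteqP; split=> [x Gx|x [j + Kx]]; last by apply.
by have [j KG /interior_subset Kx] := bK _ _ oG Gx; exists j.
Qed.

Lemma closed_sigma_compact (C : set (R * L)) : closed C -> sigma_compact C.
Proof.
move=> cC; rewrite -[C]setTI; apply: sigma_compact_closedI => //.
by apply: open_sigma_compact; exact: openT.
Qed.

End compact_base.

(** * Affine maps of the time coordinate *)

Section affine.
Context {R : realType} {L : topologicalType}.

(** The shift by [s], the rescaling [sigmat t] and its inverse are images under such maps, so
    closedness and compactness are settled once for all three. *)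
Definition affine1 (a b : R) (x : R * L) : R * L := (a * x.1 + b, x.2).

Lemma continuous_affine1 a b : continuous (affine1 a b).
Proof.
move=> x A [[U V] /= [nU nV] UV].
have h : (fun r : R => a * r + b) @ x.1 --> a * x.1 + b.
  by apply: cvgD; [apply: cvgM; [exact: cvg_cst|exact: cvg_id]|exact: cvg_cst].
exists ((fun r => a * r + b) @^-1` U, V); first by split => //=; exact: h.
by move=> y [Uy Vy]; exact: UV.
Qed.

Lemma affine1K (a b : R) : a != 0 ->
  cancel (affine1 a b) (affine1 a^-1 (- (b / a))).
Proof. by move=> a0 [r l]; rewrite /affine1/=; congr pair; field. Qed.

Lemma affine1VK (a b : R) : a != 0 ->
  cancel (affine1 a^-1 (- (b / a))) (affine1 a b).
Proof. by move=> a0 [r l]; rewrite /affine1/=; congr pair; field. Qed.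

(** Seen as a preimage under the continuous inverse map, the image of a closed set is closed. *)
Lemma affine1_image (a b : R) (Z : set (R * L)) : a != 0 ->
  affine1 a b @` Z = affine1 a^-1 (- (b / a)) @^-1` Z.
Proof.
move=> a0; apply/seteqP; split=> [_ [x Zx <-]|x /= Zx]; first by rewrite /= affine1K.
by exists (affine1 a^-1 (- (b / a)) x) => //; exact: affine1VK.
Qed.

Lemma closed_affine1 (a b : R) (Z : set (R * L)) : a != 0 -> closed Z ->
  closed (affine1 a b @` Z).
Proof.
move=> a0 cZ; rewrite affine1_image//.
by apply: preimage_closed => // x _; exact: continuous_affine1.
Qed.

Lemma compact_affine1 (a b : R) (Z : set (R * L)) : compact Z ->
  compact (affine1 a b @` Z).
Proof.
move=> cZ; apply: continuous_compact => //.
by apply: continuous_subspaceT; exact: continuous_affine1.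
Qed.

Lemma shiftE (s : R) (Z : set (R * L)) : Defs.shift s Z = affine1 1 s @` Z.
Proof.
by rewrite /Defs.shift; congr image; apply/funext=> x; rewrite /affine1 mul1r addrC.
Qed.

Lemma closed_shift (s : R) (Z : set (R * L)) : closed Z -> closed (Defs.shift s Z).
Proof. by move=> cZ; rewrite shiftE; apply: closed_affine1 => //; exact: oner_neq0. Qed.

Lemma shift_mem (s : R) (Z : set (R * L)) x : Defs.shift s Z x <-> Z (x.1 - s, x.2).
Proof.
split=> [[y Zy <-]|Zx] /=; first by rewrite addrAC subrr add0r; case: y Zy.
by exists (x.1 - s, x.2) => //=; rewrite addrC subrK; case: x Zx.
Qed.

Lemma closed_strip (a b : R) : closed (`[a, b]%classic `*` [set: L]).
Proof.
rewrite (_ : _ `*` _ = fst @^-1` `[a, b]%classic).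
  by apply: preimage_closed; [move=> x _; exact: cvg_fst|exact: interval_closed].
by apply/seteqP; split=> x /=; [case|].
Qed.

Lemma closed_slice (r : R) : closed [set x : R * L | x.1 = r].
Proof.
rewrite (_ : mkset _ = fst @^-1` [set r])//.
by apply: preimage_closed; [move=> x _; exact: cvg_fst|exact: closed_eq].
Qed.

End affine.

(** * The closed sets underlying union, rescaling and restriction *)

Section mkC.
Context {R : realType} {L : topologicalType}.
Implicit Types t : R.

Lemma proj1_sig_mkC t (Z : set (R * L)) : closed Z -> Z `<=` Xt t ->
  proj1_sig (mkC t Z) = Z.
Proof. by move=> cZ ZX; rewrite /mkC; case: pselect => // -[]. Qed.

Lemma Ct_closed t (Z : @Ct R L t) : closed (proj1_sig Z).
Proof. by case: Z => Z []. Qed.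

Lemma Ct_sub t (Z : @Ct R L t) x : proj1_sig Z x -> 0 <= x.1 <= t.
Proof. by case: Z => Z /= [_ ZX] /ZX []; rewrite /= in_itv. Qed.

Lemma Ct_inj t (Z Z' : @Ct R L t) : proj1_sig Z = proj1_sig Z' -> Z = Z'.
Proof.
by case: Z Z' => [Z h] [Z' h'] /= E; subst; congr exist; exact: Prop_irrelevance.
Qed.

Lemma proj1_oplus s t p : 0 < s -> 0 < t ->
  proj1_sig (@oplus R L s t p) = proj1_sig p.1 `|` Defs.shift s (proj1_sig p.2).
Proof.
move=> s0 t0; apply: proj1_sig_mkC.
  apply: closedU; first exact: Ct_closed.
  by apply: closed_shift; exact: Ct_closed.
by move=> x []; [move/Ct_sub|move=> /shift_mem /Ct_sub] => /= h; split=> //=;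
  rewrite in_itv/=; lra.
Qed.

Lemma proj1_sigmat t Z : 0 < t ->
  proj1_sig (@sigmat R L t Z) = affine1 t^-1 0 @` proj1_sig Z.
Proof.
move=> t0; rewrite proj1_sig_mkC.
- by congr image; apply/funext=> x; rewrite /affine1 addr0 mulrC.
- rewrite (_ : (fun x => _) = affine1 t^-1 0).
    by apply: closed_affine1; [rewrite invr_eq0 gt_eqF|exact: Ct_closed].
  by apply/funext=> x; rewrite /affine1 addr0 mulrC.
- move=> _ [x /Ct_sub /andP[x0 xt] <-]; split=> //=; rewrite in_itv/=.
  by rewrite ler_pdivrMr// mul1r xt andbT divr_ge0// ltW.
Qed.

Lemma proj1_lpart s t Z : 0 < s ->
  proj1_sig (@lpart R L s t Z) = proj1_sig Z `&` (`[0, s] `*` [set: L]).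
Proof.
move=> s0; apply: proj1_sig_mkC; last exact: subIsetr.
by apply: closedI; [exact: Ct_closed|exact: closed_strip].
Qed.

Lemma proj1_rpart s t Z :
  proj1_sig (@rpart R L s t Z) =
  Defs.shift (- s) (proj1_sig Z `&` (`[s, s + t] `*` [set: L])).
Proof.
apply: proj1_sig_mkC.
  by apply: closed_shift; apply: closedI; [exact: Ct_closed|exact: closed_strip].
move=> x /shift_mem /= [_ [/=]]; rewrite in_itv/= => /andP[h1 h2] _; split=> //=.
by rewrite in_itv/=; lra.
Qed.

(** The shifted second set lives at times at least [s], so it can add points to the strip up to [s]
    only on the slice at [s], which comes from its own slice at [0]. The right part is treated
    symmetrically. *)
Lemma lpart_oplus s t p : 0 < s -> 0 < t ->
  ~ (exists l, proj1_sig p.2 (0, l)) -> lpart s t (@oplus R L s t p) = p.1.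
Proof.
move=> s0 t0 p0; apply: Ct_inj; rewrite proj1_lpart// proj1_oplus//.
apply/seteqP; split=> [[r l] [[//|/shift_mem/= h] [/= + _]]|x px].
  rewrite in_itv/= => /andP[r0 rs]; have := Ct_sub _ _ _ h => /= /andP[+ _].
  rewrite subr_ge0 => sr; exfalso; apply: p0; exists l.
  have E : r = s by apply/eqP; rewrite eq_le rs sr.
  by rewrite E subrr in h.
by split; [left|split=> //=; rewrite in_itv/=; exact: Ct_sub px].
Qed.

Lemma rpart_oplus s t p : 0 < s -> 0 < t ->
  ~ (exists l, proj1_sig p.1 (s, l)) -> rpart s t (@oplus R L s t p) = p.2.
Proof.
move=> s0 t0 ps; apply: Ct_inj; rewrite proj1_rpart proj1_oplus//.
apply/seteqP; split=> [[r l] /shift_mem/= [+ [/= + _]]|[r l] px].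
  rewrite opprK in_itv/= => -[h|/shift_mem]/=; last by rewrite addrK.
  move=> /andP[sr _]; have := Ct_sub _ _ _ h => /= /andP[_ rs]; exfalso; apply: ps.
  have E : r + s = s by apply/eqP; rewrite eq_le rs sr.
  by exists l; rewrite E in h.
apply/shift_mem; rewrite /= opprK; split; first by right; apply/shift_mem; rewrite /= addrK.
by split=> //=; have := Ct_sub _ _ _ px => /=; rewrite in_itv/=; lra.
Qed.

(** Inverts the rescaling for [t > 0]; composing with it carries functions on the varying spaces C_t
    to the single space C_1. *)
Definition unsigmat t (Z : @Ct R L 1) : @Ct R L t :=
  mkC t (affine1 t 0 @` proj1_sig Z).

Lemma proj1_unsigmat t Z : 0 < t ->
  proj1_sig (unsigmat t Z) = affine1 t 0 @` proj1_sig Z.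
Proof.
move=> t0; apply: proj1_sig_mkC.
  by apply: closed_affine1; [rewrite gt_eqF|exact: Ct_closed].
move=> _ [x /Ct_sub /andP[x0 x1] <-]; split=> //=; rewrite in_itv/= addr0.
by rewrite mulr_ge0 ?(ltW t0)//= -[leRHS]mulr1 ler_pM2l.
Qed.

Lemma sigmatK t : 0 < t -> cancel (@sigmat R L t) (unsigmat t).
Proof.
move=> t0 Z; apply: Ct_inj; rewrite proj1_unsigmat// proj1_sigmat//.
rewrite image_comp -[RHS]image_id; apply: eq_imagel => -[r l] _ /=.
by rewrite /affine1/= !addr0 mulrA divff ?mul1r// gt_eqF.
Qed.

End mkC.

(** * Borel measurability of the operations on closed sets *)

Section fell.
Context {R : realType} {L : topologicalType}.
Hypothesis L_hausdorff : hausdorff_space L.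
Hypothesis L_locally_compact : locally_compact [set: L].
Hypothesis L_second_countable : @second_countable L.
Implicit Types t : R.

Definition miss t (F : set (R * L)) : set (@Ct R L t) :=
  [set Z | proj1_sig Z `&` F = set0].

Lemma miss_bigcup t I (P : set I) (F : I -> set (R * L)) :
  miss t (\bigcup_(i in P) F i) = \bigcap_(i in P) miss t (F i).
Proof.
apply/seteqP; split=> Z.
  by move=> ZF i Pi; apply: subsetI_eq0 ZF => // x Fx; exists i.
move=> ZF; rewrite /miss/= -subset0 => x [Zx [i Pi Fx]].
by rewrite -(ZF i Pi); split.
Qed.

Section measurability.
Context {d} {T : measurableType d} (t : R) (f : T -> @Ct R L t).
Hypothesis mf : forall K, compact K -> measurable (f @^-1` miss t K).

Let measurable_preimage_miss (F : set (R * L)) :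
  sigma_compact F -> measurable (f @^-1` miss t F).
Proof.
by move=> [K cK ->]; rewrite miss_bigcup preimage_bigcap; apply: bigcapT_measurable => n;
  exact: mf.
Qed.

Let measurable_preimage_hit (F : set (R * L)) :
  sigma_compact F -> measurable (f @^-1` [set Z | proj1_sig Z `&` F !=set0]).
Proof.
move=> sF; rewrite (_ : mkset _ = ~` miss t F).
  by rewrite -preimage_setC; apply: measurableC; exact: measurable_preimage_miss.
apply/seteqP; split=> Z /=; rewrite /miss/=; last by move=> /eqP/set0P.
by move=> [x Zx] E; rewrite E in Zx.
Qed.

(* The compact base turns every Fell-open set into a countable union of finite
   intersections of sets [miss] and [hit], so the Fell Borel sigma-algebra is
   generated by the sets [miss K] with [K] compact. *)
Lemma measurable_fun_Ct : measurable_fun setT f.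
Proof.
apply: (@measurability _ _ T (@Ct R L t) setT f (@fell_open R L t)) => //.
move=> _ [W oW <-]; rewrite setTI.
have [K [cK bK]] :=
  exists_compact_base (R := R) L_hausdorff L_locally_compact L_second_countable.
(* A countable subbase: avoid a compact set of the base, or hit the interior of one. *)
pose b (j : bool * ((rat * rat) * nat)) : set (@Ct R L t) :=
  if j.1 then miss t (K j.2) else [set Z | proj1_sig Z `&` (K j.2)° !=set0].
pose fin s := foldr setI setT [seq b j | j <- s].
have fincat s1 s2 : fin (s1 ++ s2) = fin s1 `&` fin s2.
  by rewrite /fin map_cat; elim: s1 => [|j s1 /= ->]; rewrite ?setTI// setIA.
have mb j : measurable (f @^-1` b j).
  rewrite /b; case: j.1; first exact: mf.
  apply: measurable_preimage_hit; apply: open_sigma_compact => //.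
  exact: open_interior.
have mfin s : measurable (f @^-1` fin s).
  elim: s => [|j s mb']; first by rewrite preimage_setT.
  by rewrite /fin/= preimage_setI; exact: measurableI.
(* Around each of its points, a subbasic set of the Fell topology contains a finite intersection of
   sets [b j]. *)
have sub_fin S Z : fell_subbase t S -> S Z -> exists2 s, fin s Z & fin s `<=` S.
  case=> [[C [cC CX ->]]|[G [oG ->]]] /=.
  - move=> ZC.
    (* The point is interior to a base set avoiding [Z] with code at most [n]. This grows with [n],
       so compactness of [C] yields one [n] valid on all of [C]: a finite subcover expressed as a
       bound on codes. *)
    pose P (n : nat) x := exists j,
      [/\ (pickle j <= n)%N, K j `<=` ~` proj1_sig Z & (K j)° x].
    have [n _ nP] : \forall n \near \oo, C `<=` P n.
      apply: (compact_near_coveringP C).1 => // x Cx.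
      have [||j Kj jx] := bK (~` proj1_sig Z) x.
      + by apply: closed_openC; exact: Ct_closed.
      + move=> Zx; move: ZC => /seteqP[/(_ x) + _]; apply; split => //.
      exists ((K j)°, [set n | (pickle j <= n)%N]) => /=.
        split; last by exists (pickle j).
        by apply: open_nbhs_nbhs; split => //; exact: open_interior.
      by move=> [y n] /= [jy jn]; exists j.
    pose D := [seq j <- pmap unpickle (iota 0 n.+1) | `[< K j `<=` ~` proj1_sig Z >]].
    have Cov x : C x -> exists2 j, j \in D & (K j)° x.
      move=> /(nP n (leqnn n)) [j [jn jZ jx]]; exists j => //.
      rewrite mem_filter; apply/andP; split; first exact/asboolP.
      by rewrite mem_pmap; apply/mapP; exists (pickle j); rewrite ?pickleK// mem_iota.
    exists [seq (true, j) | j <- D]; rewrite /fin -map_comp.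
    + have : {in D, forall j, b (true, j) Z}.
        move=> j; rewrite mem_filter => /andP[/asboolP jZ _].
        by rewrite /b/= /miss/= -subset0 => x [Zx /jZ].
      elim: D {Cov} => //= j s IH h; split; first by apply: h; rewrite mem_head.
      by apply: IH => k ks; apply: h; rewrite in_cons ks orbT.
    + move=> Y hY /=; rewrite -subset0 => x [Yx /Cov [j /= jD jx]].
      have : b (true, j) Y.
        elim: D jD hY {Cov} => //= i s IH; rewrite in_cons => /orP[/eqP ->[]//|js].
        by case=> _; exact: IH.
      rewrite /b/= /miss/= => /seteqP[/(_ x) h _]; apply: h; split=> //.
      exact: interior_subset.
  - move=> [x [Zx Gx]]; have [j KG jx] := bK _ _ oG Gx.
    exists [:: (false, j)]; rewrite /fin/= /b/=; first by split=> //; exists x.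
    by move=> Y [[y [Yy /interior_subset /KG Gy]] _]; exists y.
(* Finite lists over a countable type form a countable type, so this union is countable. *)
have -> : W = \bigcup_s (if `[< fin s `<=` W >] then fin s else set0).
  apply/seteqP; split=> [Z WZ|Z [s _]]; last by case: asboolP => // h /h.
  have [l [lS lZ lW]] := oW Z WZ.
  suff [s sZ sl] : exists2 s, fin s Z & fin s `<=` foldr setI setT l.
    by exists s => //; case: asboolP => // -[]; exact: subset_trans sl lW.
  elim: l lS lZ {lW} => [_ _|S l IH lS [/= SZ lZ]]; first by exists [::].
  have [s1 s1Z s1S] := sub_fin S Z (lS _ (mem_head _ _)) SZ.
  have [|s2 s2Z s2l] := IH _ lZ; first by move=> S' S'l; apply: lS; rewrite in_cons S'l orbT.
  by exists (s1 ++ s2); rewrite fincat; [split|exact: setISS].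
rewrite preimage_bigcup; apply: countable_bigcupT_measurable => [//|s].
by case: asboolP => _ //; rewrite preimage_set0.
Qed.

End measurability.

Lemma measurable_miss t (F : set (R * L)) : sigma_compact F ->
  measurable (miss t F : set (@Ct R L t)).
Proof.
move=> [K cK ->]; rewrite miss_bigcup; apply: bigcapT_measurable => n.
apply: sub_sigma_algebra => Z ZK; exists [:: miss t (K n)]; split=> /=.
(* The subbase only has compacts inside [Xt t]; cutting [K n] by this strip does not affect which
   closed subsets of it are disjoint from [K n]. *)
- move=> S; rewrite inE => /eqP ->; left; exists (K n `&` Xt t); split.
  + by apply: compact_closedI; [exact: cK|exact: closed_strip].
  + exact: subIsetr.
  + apply/seteqP; split=> Y; rewrite /miss/= => E; apply/seteqP; split=> // x [Yx].
      by move=> [Kx _]; rewrite -E.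
    by move=> Kx; rewrite -E; split=> //; split=> //; case: (Y) Yx => ? [? h] /= /h.
- by split.
- by rewrite setIT.
Qed.

(** As in the lemmas that follow, the preimage of [miss K] is again a set of this form, or a product
    of two for [oplus], with [K] moved back by the inverse affine map and, for the two parts, cut by
    a strip. *)
Lemma measurable_sigmat t : 0 < t -> measurable_fun setT (@sigmat R L t).
Proof.
move=> t0; apply: measurable_fun_Ct => K cK.
rewrite (_ : _ @^-1` _ = miss t (affine1 t 0 @` K)).
  by apply: measurable_miss; apply: compact_sigma_compact; exact: compact_affine1.
have tN0 : t != 0 by rewrite gt_eqF.
apply/seteqP; split=> Z; rewrite /miss/= proj1_sigmat// => E;
  rewrite -subset0 => x [].
  move=> Zx [y Ky yx]; suff : set0 y by [].
  rewrite -E; split; last exact: Ky.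
  by exists x => //; rewrite -yx /affine1/= !addr0 mulKf//; case: (y).
move=> [y Zy yx] Kx; suff : set0 y by [].
rewrite -E; split; first exact: Zy.
by exists x => //; rewrite -yx /affine1/= !addr0 mulVKf//; case: (y).
Qed.

Lemma measurable_unsigmat t : 0 < t -> measurable_fun setT (@unsigmat R L t).
Proof.
move=> t0; apply: measurable_fun_Ct => K cK.
rewrite (_ : _ @^-1` _ = miss 1 (affine1 t^-1 0 @` K)).
  by apply: measurable_miss; apply: compact_sigma_compact; exact: compact_affine1.
have tN0 : t != 0 by rewrite gt_eqF.
apply/seteqP; split=> Z; rewrite /miss/= proj1_unsigmat// => E;
  rewrite -subset0 => x [].
  move=> Zx [y Ky yx]; suff : set0 y by [].
  rewrite -E; split; last exact: Ky.
  by exists x => //; rewrite -yx /affine1/= !addr0 mulVKf//; case: (y).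
move=> [y Zy yx] Kx; suff : set0 y by [].
rewrite -E; split; first exact: Zy.
by exists x => //; rewrite -yx /affine1/= !addr0 mulKf//; case: (y).
Qed.

Lemma measurable_lpart s t : 0 < s -> measurable_fun setT (@lpart R L s t).
Proof.
move=> s0; apply: measurable_fun_Ct => K cK.
rewrite (_ : _ @^-1` _ = miss (s + t) (K `&` (`[0, s]%classic `*` [set: L]))).
  apply: measurable_miss; apply: compact_sigma_compact; apply: compact_closedI => //.
  exact: closed_strip.
by apply/seteqP; split=> Z; rewrite /miss/= proj1_lpart// setIAC -setIA.
Qed.

Lemma measurable_rpart s t : measurable_fun setT (@rpart R L s t).
Proof.
apply: measurable_fun_Ct => K cK.
rewrite (_ : _ @^-1` _ = miss (s + t) (Defs.shift s K `&` (`[s, s + t]%classic `*` [set: L]))).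
  apply: measurable_miss; apply: compact_sigma_compact; apply: compact_closedI.
    by rewrite shiftE; exact: compact_affine1.
  exact: closed_strip.
apply/seteqP; split=> Z; rewrite /miss/= proj1_rpart => E; rewrite -subset0 => x [].
  move=> Zx [/shift_mem Kx xI]; suff : set0 (x.1 - s, x.2) by [].
  rewrite -E; split; last exact: Kx.
  by apply/shift_mem; rewrite /= opprK subrK; split=> //; case: (x) Zx.
move=> /shift_mem/= ; rewrite opprK => -[Zx xI] Kx.
suff : set0 (x.1 + s, x.2) by [].
rewrite -E; split; first exact: Zx.
by split=> //; apply/shift_mem; rewrite /= addrK; case: (x) Kx.
Qed.

Lemma measurable_oplus s t : 0 < s -> 0 < t -> measurable_fun setT (@oplus R L s t).
Proof.
move=> s0 t0; apply: measurable_fun_Ct => K cK.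
rewrite (_ : _ @^-1` _ = (miss s K : set (@Ct R L s)) `*` miss t (Defs.shift (- s) K)).
  apply: measurableX; apply: measurable_miss; apply: compact_sigma_compact => //.
  by rewrite shiftE; exact: compact_affine1.
apply/seteqP; split=> -[Z1 Z2]; rewrite /miss/= proj1_oplus//=.
  move=> /seteqP[+ _]; rewrite setIUl subUset => -[h1 h2]; split.
    by apply/seteqP; split.
  rewrite -subset0 => x [Zx /shift_mem]; rewrite opprK => Kx.
  by apply: (h2 (x.1 + s, x.2)); split; last exact: Kx; apply/shift_mem => /=; rewrite addrK; case: (x) Zx.
move=> [E1 E2]; rewrite setIUl E1 set0U -subset0 => x [/shift_mem Zx Kx].
suff : set0 (x.1 - s, x.2) by [].
rewrite -E2; split; first exact: Zx.
by apply/shift_mem; rewrite /= opprK subrK; case: (x) Kx.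
Qed.

Lemma measurable_hit_slice t (r : R) :
  measurable [set Z : @Ct R L t | exists l, proj1_sig Z (r, l)].
Proof.
rewrite (_ : mkset _ = ~` miss t [set x | x.1 = r]).
  apply: measurableC; apply: measurable_miss; apply: closed_sigma_compact => //.
  exact: closed_slice.
apply/seteqP; split=> Z /=; rewrite /miss/=.
  by move=> [l Zl] E; have : set0 (r, l) by rewrite -E.
by move/eqP/set0P => [[r' l] [Zl /= rr]]; subst; exists l.
Qed.

Lemma measurable_empty t : measurable [set CtT0 t : @Ct R L t].
Proof.
rewrite (_ : [set _] = miss t setT).
  by apply: measurable_miss; apply: open_sigma_compact => //; exact: openT.
apply/seteqP; split=> Z /=; rewrite /miss/= setIT; first by move=> ->.
by move=> E; exact: Ct_inj.
Qed.

End fell.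

(** * Densities *)

Section density.
Local Open Scope ereal_scope.
Context {R : realType}.

(** Packs the set function [pushforward P f] as a probability; the equality of set functions then
    transports integrals between the two. *)
Lemma pushforward_probability d d' (T : measurableType d) (T' : measurableType d')
    (P : probability T R) (f : T -> T') : measurable_fun setT f ->
  exists Q : probability T' R, Q = pushforward P f :> (set T' -> \bar R).
Proof.
move=> mf.
pose F : {mfun T >-> T'} := HB.pack f (isMeasurableFun.Build _ _ _ _ f mf).
by exists (distribution P F).
Qed.

Lemma density_finite_measure d (T : measurableType d)
    (m : {measure set T -> \bar R}) (w : T -> R) :
  measurable_fun setT w -> (forall x, 0 <= w x)%R ->
  \int[m]_x (w x)%:E < +oo ->
  exists n : {finite_measure set T -> \bar R},
    n = (fun A => \int[m]_(x in A) (w x)%:E) :> (set T -> \bar R).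
Proof.
move=> mw w0 wfin; pose f A := \int[m]_(x in A) (w x)%:E.
have f0 : f set0 = 0 by rewrite /f integral_set0.
have fge0 A : 0 <= f A by apply: integral_ge0 => x _; rewrite lee_fin.
have fsa : semi_sigma_additive f.
  by apply: semi_sigma_additive_nng_induced; [exact/measurable_EFinP|move=> x; rewrite lee_fin].
pose n : measure T R := HB.pack f (isMeasure.Build _ _ _ f f0 fge0 fsa).
have nfin : fin_num_fun n.
  move=> A mA; rewrite ge0_fin_numE ?fge0//; apply: le_lt_trans wfin.
  apply: ge0_subset_integral => //; first exact/measurable_EFinP.
  by move=> x _; rewrite lee_fin.
pose n' : {finite_measure set T -> \bar R} :=
  HB.pack f (isMeasure.Build _ _ _ f f0 fge0 fsa) (Measure_isFinite.Build _ _ _ n nfin).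
by exists n'.
Qed.

Lemma density_probability d (T : measurableType d)
    (m : {measure set T -> \bar R}) (w : T -> R) :
  measurable_fun setT w -> (forall x, 0 <= w x)%R ->
  \int[m]_x (w x)%:E = 1 ->
  exists n : probability T R,
    n = (fun A => \int[m]_(x in A) (w x)%:E) :> (set T -> \bar R).
Proof.
move=> mw w0 w1.
have [|n nE] := density_finite_measure _ _ m w mw w0; first by rewrite w1 ltry.
have n1 : n setT = 1 by rewrite nE.
pose n' : probability T R := HB.pack (FiniteMeasure.sort n) (Measure_isProbability.Build _ _ _ n n1).
by exists n'.
Qed.

Lemma density_dominates d (T : measurableType d)
    (m : {measure set T -> \bar R}) (n : set T -> \bar R) (w : T -> R) :
  measurable_fun setT w ->
  (forall A, measurable A -> n A = \int[m]_(x in A) (w x)%:E) -> n `<< m.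
Proof.
move=> mw nE N N0 A mA AN; rewrite nE//; apply: null_set_integral => //.
  by apply/measurable_EFinP; exact: measurable_funTS.
exact: N0.
Qed.

(** The change of variables is known for the Radon-Nikodym derivative of [n], and that derivative
    agrees with [w] almost everywhere because both have the same integral over every measurable
    set. *)
Lemma density_integral d (T : measurableType d)
    (m : {sigma_finite_measure set T -> \bar R})
    (n : {finite_measure set T -> \bar R}) (w : T -> R) :
  measurable_fun setT w ->
  (forall A, measurable A -> n A = \int[m]_(x in A) (w x)%:E) ->
  forall (E : set T) (F : T -> \bar R), measurable E -> measurable_fun setT F ->
  (forall x, 0 <= F x) ->
  \int[n]_(x in E) F x = \int[m]_(x in E) (F x * (w x)%:E).
Proof.
move=> mw nE E F mE mF F0.
have nm : n `<< m := density_dominates _ _ m n w mw nE.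
have mFE : measurable_fun E F by exact: measurable_funTS.
rewrite -(Radon_Nikodym_SigmaFinite.change_of_variables nm F0 mE mFE).
have RNi := Radon_Nikodym_SigmaFinite.f_integrable nm.
have mRN := measurable_int _ RNi.
apply: ae_eq_integral => //.
- by apply: emeasurable_funM => //; exact: measurable_funTS.
- by apply: emeasurable_funM => //; apply/measurable_EFinP; exact: measurable_funTS.
have : ae_eq m setT (Radon_Nikodym_SigmaFinite.f n m) (EFin \o w).
  apply: integral_ae_eq => //; first exact/measurable_EFinP.
  by move=> A _ mA; rewrite -Radon_Nikodym_SigmaFinite.f_integral// nE.
by apply: filterS => x /= h _; rewrite h.
Qed.

Lemma ge0_integral_prod_rect d d' (T : measurableType d) (T' : measurableType d')
    (m : {sigma_finite_measure set T -> \bar R})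
    (m' : {sigma_finite_measure set T' -> \bar R})
    (f : T -> R) (g : T' -> R) (A : set T) (B : set T') :
  measurable_fun setT f -> measurable_fun setT g ->
  (forall x, 0 <= f x)%R -> (forall y, 0 <= g y)%R -> measurable A -> measurable B ->
  \int[m \x m']_(z in A `*` B) (f z.1 * g z.2)%:E =
  \int[m]_(x in A) (f x)%:E * \int[m']_(y in B) (g y)%:E.
Proof.
move=> mf mg f0 g0 mA mB.
rewrite [LHS]integral_mkcond [X in X * _]integral_mkcond [X in _ * X]integral_mkcond.
have mfA : measurable_fun setT ((fun x => (f x)%:E) \_ A).
  by apply/(measurable_restrictT _ mA)/measurable_EFinP; exact: measurable_funTS.
have mgB : measurable_fun setT ((fun x => (g x)%:E) \_ B).
  by apply/(measurable_restrictT _ mB)/measurable_EFinP; exact: measurable_funTS.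
have fA0 x : 0 <= ((fun x => (f x)%:E) \_ A) x.
  by apply: erestrict_ge0 => // y _; rewrite lee_fin.
have gB0 x : 0 <= ((fun x => (g x)%:E) \_ B) x.
  by apply: erestrict_ge0 => // y _; rewrite lee_fin.
have E : (fun z => (f z.1 * g z.2)%:E) \_ (A `*` B) =
    (fun z => ((fun x => (f x)%:E) \_ A) z.1 * ((fun x => (g x)%:E) \_ B) z.2).
  apply/funext=> -[x y]; rewrite !patchE /=.
  case: (boolP (x \in A)) => xA; case: (boolP (y \in B)) => yB.
  - by rewrite ifT ?EFinM// inE; split; [exact: set_mem xA|exact: set_mem yB].
  - by rewrite mule0 ifF//; apply/negbTE; apply: contra yB; rewrite !inE => -[].
  - by rewrite mul0e ifF//; apply/negbTE; apply: contra xA; rewrite !inE => -[].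
  - by rewrite mul0e ifF//; apply/negbTE; apply: contra xA; rewrite !inE => -[].
rewrite E fubini_tonelli1//=; last 2 first.
- by apply: emeasurable_funM; exact: measurableT_comp.
- by move=> z; rewrite mule_ge0.
rewrite /fubini_F/= -ge0_integralZr//; last by apply: integral_ge0.
by apply: eq_integral => x _; rewrite ge0_integralZl.
Qed.

(** The product density defines a probability that agrees with [n \x n'] on rectangles, and a
    product measure is determined by its values there. *)
Lemma product_density d d' (T : measurableType d) (T' : measurableType d')
    (m n : probability T R) (m' n' : probability T' R) (f : T -> R) (g : T' -> R) :
  measurable_fun setT f -> measurable_fun setT g ->
  (forall x, 0 <= f x)%R -> (forall y, 0 <= g y)%R ->
  (forall A, measurable A -> n A = \int[m]_(x in A) (f x)%:E) ->
  (forall A, measurable A -> n' A = \int[m']_(x in A) (g x)%:E) ->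
  forall C, measurable C ->
  (n \x n') C = \int[m \x m']_(z in C) (f z.1 * g z.2)%:E.
Proof.
move=> mf mg f0 g0 nE n'E C mC.
have mfg : measurable_fun setT (fun z : T * T' => f z.1 * g z.2)%R.
  by apply: measurable_funM; exact: measurableT_comp.
have rect := ge0_integral_prod_rect _ _ T T' m m' f g _ _ mf mg f0 g0.
have fg1 : \int[m \x m']_z (f z.1 * g z.2)%:E = 1.
  by rewrite -setXTT rect// -nE// -n'E// !probability_setT mule1.
have [p pE] := density_probability _ _ (m \x m') _ mfg
  (fun z => mulr_ge0 (f0 z.1) (g0 z.2)) fg1.
transitivity (p C); last by rewrite pE.
apply: product_measure_unique => // A B mA mB.
transitivity (n A * n' B) => //.
rewrite nE// n'E// -rect//; exact: (congr1 (fun q => q (A `*` B)) pE).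
Qed.

End density.

(** * Measurable dependence on a parameter *)

Section step.
Context {R : realType} {d} {T : measurableType d} (e : nat -> set T).

(** Rational coefficients and indices in [nat] make the lists a countable type, so that suprema over
    all step functions are countable. *)
Definition step (l : seq (rat * nat)) (x : T) : R :=
  \sum_(p <- l) ratr p.1 * \1_(e p.2) x.

Lemma step_cat l l' x : step (l ++ l') x = step l x + step l' x.
Proof. exact: big_cat. Qed.

Lemma step_scale q l x :
  step [seq (q * p.1, p.2) | p <- l] x = ratr q * step l x.
Proof.
rewrite /step big_map mulr_sumr; apply: eq_bigr => p _ /=.
by rewrite rmorphM mulrA.
Qed.

Hypothesis me : forall n, measurable (e n).

Lemma measurable_step l : measurable_fun setT (step l).
Proof.
rewrite /step; elim: l => [|p l IH].
  by under eq_fun do rewrite big_nil; exact: measurable_cst.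
under eq_fun do rewrite big_cons.
by apply: measurable_funD => //; apply: measurable_funM.
Qed.

Lemma step_bounded l : exists2 M : R, 0 <= M & forall x, `|step l x| <= M.
Proof.
rewrite /step; elim: l => [|p l [M M0 IH]].
  by exists 0 => // x; rewrite big_nil normr0.
exists (`|ratr p.1| + M) => [|x]; first by rewrite addr_ge0.
rewrite big_cons (le_trans (ler_normD _ _))// lerD// normrM ler_piMr//.
by rewrite indicE; case: (_ \in _); rewrite ?normr1 ?normr0.
Qed.

End step.

Arguments step {R d T} e l x.

(** * Density of rational step functions in [L^2(A, m)] *)

Section step_approximation.
Import HBNNSimple.
Context {R : realType} {d} {T : measurableType d} (e : nat -> set T).
Hypothesis me : forall n, measurable (e n).
Hypothesis eI : setI_closed (range e).
Hypothesis e_gen : <<s range e >> = @measurable _ T.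
Context (m : {finite_measure set T -> \bar R}) (A : set T).
Hypothesis eA : range e A.

Let mA : measurable A. Proof. by case: eA => n _ <-. Qed.

(** The squared norm of [L^2(A, m)], kept in the extended reals so that it makes sense before
    integrability is known. *)
Let N (f : T -> R) := (\int[m]_(x in A) ((f x) ^+ 2)%:E)%E.

Let mN (f : T -> R) : measurable_fun setT f ->
  measurable_fun A (fun x => ((f x) ^+ 2)%:E).
Proof.
move=> mf; apply/measurable_EFinP; apply: measurable_funTS.
exact: measurable_funX.
Qed.

(** This inequality, from the parallelogram law, stands in for the triangle inequality; its factor 2
    is why [eps / 4] appears below. *)
Let ND (f g : T -> R) : measurable_fun setT f -> measurable_fun setT g ->
  (N (f \+ g)%R <= 2%:E * (N f + N g))%E.
Proof.
move=> mf mg; rewrite /N -ge0_integralD//; last 4 first.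
- by move=> x _; rewrite lee_fin sqr_ge0.
- exact: mN.
- by move=> x _; rewrite lee_fin sqr_ge0.
- exact: mN.
rewrite -ge0_integralZl//; last 2 first.
- by apply: emeasurable_funD; exact: mN.
- by move=> x _; rewrite -EFinD lee_fin addr_ge0// sqr_ge0.
apply: ge0_le_integral => //.
- by move=> x _; rewrite lee_fin sqr_ge0.
- by apply: mN; exact: measurable_funD.
- apply/measurable_EFinP; apply: measurable_funTS; apply: measurable_funM => //.
  by apply: measurable_funD; exact: measurable_funX.
- move=> x _; rewrite -EFinD -EFinM lee_fin /=.
  by have := sqr_ge0 (f x - g x); nra.
Qed.

Let approximable (f : T -> R) := measurable_fun setT f /\
  forall eps : R, 0 < eps -> exists l, (N (f \- step e l)%R <= eps%:E)%E.

Let approximableD (f g : T -> R) :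
  approximable f -> approximable g -> approximable (f \+ g).
Proof.
move=> [mf af] [mg ag]; split; first exact: measurable_funD.
move=> eps eps0; have [l fl] := af (eps / 4) ltac:(lra).
have [k gk] := ag (eps / 4) ltac:(lra); exists (l ++ k).
rewrite (_ : _ \- _ = (f \- step e l) \+ (g \- step e k)); last first.
  by apply/funext=> x /=; rewrite step_cat opprD addrACA.
apply: (le_trans (ND _ _ _ _)); try by apply: measurable_funB => //; exact: measurable_step.
apply: (@le_trans _ _ (2%:E * ((eps / 4)%:E + (eps / 4)%:E))%E).
  by rewrite lee_pmul2l// leeD.
by rewrite -EFinD -EFinM lee_fin; lra.
Qed.

Let approximable_ratscale (q : rat) (f : T -> R) :
  approximable f -> approximable (fun x => ratr q * f x).
Proof.
move=> [mf af]; split; first exact: measurable_funM.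
(* Adding 1 to the square of [q] keeps the denominator positive when [q] is 0. *)
move=> eps eps0; have c0 : 0 < (ratr q : R) ^+ 2 + 1 by have := sqr_ge0 (ratr q : R); lra.
have [l fl] := af (eps / ((ratr q) ^+ 2 + 1)) (divr_gt0 eps0 c0).
exists [seq (q * p.1, p.2) | p <- l].
have mfl : measurable_fun setT (f \- step e l).
  by apply: measurable_funB => //; exact: measurable_step.
have -> : N (fun x => ratr q * f x - step e [seq (q * p.1, p.2) | p <- l] x) =
    (((ratr q) ^+ 2)%:E * N (f \- step e l)%R)%E.
  rewrite /N -ge0_integralZl//; last 3 first.
  - exact: mN.
  - by move=> x _; rewrite lee_fin sqr_ge0.
  - by rewrite lee_fin sqr_ge0.
  apply: eq_integral => x _; rewrite step_scale -mulrBr exprMn EFinM//.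
apply: (@le_trans _ _ (((ratr q) ^+ 2)%:E * (eps / ((ratr q) ^+ 2 + 1))%:E)%E).
  by apply: lee_wpmul2l => //; rewrite lee_fin sqr_ge0.
rewrite -EFinM lee_fin mulrA ler_pdivrMr// mulrC ler_pM2l//; lra.
Qed.

Let approximable_near (f : T -> R) : measurable_fun setT f ->
  (forall eps : R, 0 < eps -> exists2 g, approximable g & (N (f \- g)%R <= eps%:E)%E) ->
  approximable f.
Proof.
move=> mf af; split => // eps eps0; have [g [mg ag] fg] := af (eps / 4) ltac:(lra).
have [l gl] := ag (eps / 4) ltac:(lra); exists l.
rewrite (_ : _ \- _ = (f \- g) \+ (g \- step e l)); last first.
  by apply/funext=> x /=; rewrite addrA subrK.
apply: (le_trans (ND _ _ _ _)).
- exact: measurable_funB.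
- by apply: measurable_funB => //; exact: measurable_step.
apply: (@le_trans _ _ (2%:E * ((eps / 4)%:E + (eps / 4)%:E))%E).
  by rewrite lee_pmul2l// leeD.
by rewrite -EFinD -EFinM lee_fin; lra.
Qed.

(** Dominated convergence sends the squared distance between [f] and [g n] to 0, and limits of
    approximable functions are approximable. *)
Let approximable_cvg (f : T -> R) (g : nat -> T -> R) (G : T -> R) :
  measurable_fun setT f -> (forall n, approximable (g n)) ->
  (forall x, g n x @[n --> \oo] --> f x) ->
  m.-integrable A (EFin \o G) ->
  (forall n x, (f x - g n x) ^+ 2 <= G x) -> approximable f.
Proof.
move=> mf ag gf iG fgG; apply: approximable_near => // eps eps0.
have : (N (f \- g n)%R @[n --> \oo] --> \int[m]_(x in A) (cst 0) x)%E.
  apply: (@dominated_cvg _ _ _ m A mA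
    (fun n x => ((f x - g n x) ^+ 2)%:E) (cst 0%E) (EFin \o G)) => //.
  - by move=> n; apply: (mN (f \- g n)); apply: measurable_funB => //; case: (ag n).
  - move=> x _; have h : (f x - g n x) ^+ 2 @[n --> \oo] --> 0.
      rewrite (_ : 0 = (f x - f x) * (f x - f x)); last by rewrite subrr mulr0.
      rewrite [X in X @ _ --> _](_ : _ = fun n => (f x - g n x) * (f x - g n x)).
        by apply: cvgM; apply: cvgB => //; exact: cvg_cst.
      by apply/funext=> n /=; rewrite expr2.
    by apply/fine_cvgP; split; [near=> n|exact: h].
  - by move=> n x _; rewrite /= lee_fin ger0_norm ?sqr_ge0.
rewrite integral0 => /fine_cvgP[finN /cvgrPdist_lt /(_ _ eps0)] [n0 _ H].
have [n1 _ H1] := finN.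
exists (g (maxn n0 n1)) => //.
have /= := H (maxn n0 n1) (leq_maxl _ _); have /= := H1 (maxn n0 n1) (leq_maxr _ _).
move=> fin; rewrite sub0r normrN -lte_fin => h.
rewrite -(fineK fin); apply/ltW; apply: le_lt_trans h.
by rewrite lee_fin ler_norm.
Unshelve. all: by end_near. Qed.

(** A Dynkin class argument: the sets with approximable indicator are stable under proper
    differences and increasing unions, and they contain the generating family [range e], which is
    stable under intersection. *)
Let approximable_indic (B : set T) : measurable B -> approximable (\1_B).
Proof.
move=> mB; suff : <<s setT, range e >> `<=` [set B | measurable B /\ approximable (\1_B)].
  by move=> /(_ B) []//; rewrite e_gen.
have step1 C : range e C -> approximable \1_C.
  move=> [n _ <-]; split=> // eps eps0; exists [:: (1, n)].
  rewrite /N integral0_eq ?lee_fin ?ltW// => x _.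
  by rewrite /= /step big_seq1/= rmorph1 mul1r subrr expr0n.
(* On [A] the constant 1 coincides with the indicator of [A]; this is where [A] has to be one of the
   sets of the sequence. *)
have approx1 : approximable (cst 1).
  split=> // eps eps0; have [_ /(_ _ eps0)[l H]] := step1 _ eA; exists l.
  apply: le_trans H; rewrite le_eqVlt; apply/orP; left; apply/eqP.
  by apply: eq_integral => x xA /=; rewrite indicE xA.
apply: lambda_system_subset => //.
- split => //.
  + split=> //; rewrite (_ : \1_setT = cst 1)//; apply/funext=> x.
    by rewrite indicE in_setT.
  + move=> X Y YX [mX aX] [mY aY]; split; first exact: measurableD.
    have := approximableD _ _ aX (approximable_ratscale (- 1) _ aY).
    rewrite [X in approximable X -> _](_ : _ = \1_(X `\` Y))//; apply/funext=> x /=.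
    rewrite rmorphN1 mulN1r !indicE in_setD.
    case: (boolP (x \in Y)) => xY; rewrite /= ?andbF ?andbT ?subr0//.
    by rewrite (mem_set (YX _ (set_mem xY))) subrr.
  + move=> F ndF FH; have mF : measurable (\bigcup_n F n).
      by apply: bigcup_measurable => n _; case: (FH n).
    split => //; apply: (approximable_cvg _ (fun n => \1_(F n)) (cst 1)) => //.
    * by move=> n; case: (FH n).
    * move=> x; apply: cvg_near_cst; rewrite /= indicE.
      case: (boolP (x \in _)) => [/set_mem[k _ Fk]|xF].
        exists k => // n /= kn; rewrite indicE mem_set//.
        by move: (ndF _ _ kn) => /subsetPset; apply.
      by exists 0%N => // n _; rewrite indicE memNset// => Fn; move: xF;
        rewrite notin_setE; apply; exists n.
    * by apply: (@finite_measure_integrable_cst _ _ _ m A 1).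
    * move=> n x; rewrite !indicE; case: (_ \in _); case: (_ \in _);
      by rewrite /= ?subrr ?subr0 ?sub0r ?sqrrN ?expr0n ?expr1n.
- by move=> C eC; split; [case: eC => n _ <-|exact: step1].
Qed.

Let approximable_scale_indic (c : R) (B : set T) : measurable B ->
  approximable (fun x => c * \1_B x).
Proof.
move=> mB; apply: approximable_near => [|eps eps0]; first exact: measurable_funM.
pose M := fine (m A); have M0 : 0 <= M by rewrite fine_ge0.
(* The bound 1 gives [del ^+ 2 <= del], and the other bound makes [del * M] at most [eps], also when
   [M] is 0. *)
pose del := Num.min 1 (eps / (M + 1)).
have del0 : 0 < del by rewrite lt_min ltr01 divr_gt0// ltr_wpDl.
have [q] := @rat_in_itvoo R (c - del) c ltac:(lra).
rewrite in_itv/= => /andP[q1 q2].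
exists (fun x => ratr q * \1_B x).
  exact: approximable_ratscale (approximable_indic _ mB).
apply: (@le_trans _ _ (\int[m]_(x in A) (cst del%:E) x)%E).
  apply: ge0_le_integral => //.
  - by move=> x _; rewrite lee_fin sqr_ge0.
  - by apply: mN; apply: measurable_funB; exact: measurable_funM.
  - move=> x _; rewrite lee_fin/= -mulrBl exprMn.
    have d1 : del <= 1 by rewrite ge_min lexx.
    apply: (@le_trans _ _ ((c - ratr q) ^+ 2)).
      rewrite ler_piMr ?sqr_ge0// indicE; case: (_ \in _);
      by rewrite ?expr1n ?expr0n.
    by nra.
have -> : (\int[m]_(x in A) (cst del%:E) x)%E = (del * M)%:E.
  by rewrite integral_cst// EFinM fineK// fin_num_measure.
rewrite lee_fin.
apply: (@le_trans _ _ (eps / (M + 1) * M)).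
  by rewrite ler_wpM2r// ge_min lexx orbT.
by rewrite mulrAC ler_pdivrMr ?ltr_wpDl// ler_pM2l//; lra.
Qed.

Let approximable_nnsfun (h : {nnsfun T >-> R}) : approximable h.
Proof.
have -> : (h : T -> R) = fun x => \sum_(y <- finmap.enum_fset (fset_set (range h))) y * \1_(h @^-1` [set y]) x.
  by apply/funext=> x; rewrite fimfunE fsbig_finite.
elim: (finmap.enum_fset _) => [|y s IH].
  under eq_fun do rewrite big_nil.
  have := approximable_scale_indic 0 _ measurableT.
  by under eq_fun do rewrite mul0r.
under eq_fun do rewrite big_cons.
exact: approximableD (approximable_scale_indic _ _ _) IH.
Qed.

Let approximable_ge0 (f : T -> R) : measurable_fun setT f -> (forall x, 0 <= f x) ->
  m.-integrable A (fun x => ((f x) ^+ 2)%:E) -> approximable f.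
Proof.
move=> mf f0 if2.
have mEf : measurable_fun setT (EFin \o f) by exact/measurable_EFinP.
pose h := nnsfun_approx measurableT mEf.
have hf x : h n x @[n --> \oo] --> f x.
  have := @cvg_nnsfun_approx _ _ _ _ measurableT _ mEf (fun x _ => f0 x) x I.
  by move=> /fine_cvgP[].
have hlef n x : h n x <= f x.
  rewrite -(cvg_lim (@Rhausdorff R) (hf x)).
  apply: nondecreasing_cvgn_le; last by apply/cvg_ex; exists (f x); exact: hf.
  by move=> a b ab; exact/lefP/nd_nnsfun_approx.
apply: (approximable_cvg _ (fun n => h n) (fun x => (f x) ^+ 2)) => //.
move=> n x; have h0 : 0 <= h n x by [].
by have := hlef n x; have := f0 x; nra.
Qed.

Lemma step_L2_dense (f : T -> R) : measurable_fun setT f ->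
  m.-integrable A (fun x => ((f x) ^+ 2)%:E) ->
  forall eps : R, 0 < eps -> exists l,
  (\int[m]_(x in A) ((f x - step e l x) ^+ 2)%:E <= eps%:E)%E.
Proof.
move=> mf if2.
(* To be applied to the positive and the negative part of [f]. *)
have part (g : T -> R) : measurable_fun setT g -> (forall x, 0 <= g x) ->
    (forall x, g x ^+ 2 <= f x ^+ 2) -> approximable g.
  move=> mg g0 gf; apply: approximable_ge0 => //.
  apply: le_integrable if2 => //; first exact: mN.
  by move=> x _; rewrite /= lee_fin !ger0_norm ?sqr_ge0.
have afp : approximable (fun x => Num.max (f x) 0).
  apply: part => [|x|x]; first exact: measurable_maxr.
    by rewrite le_max lexx orbT.
  by case: (leP (f x) 0) => h; rewrite ?expr0n ?sqr_ge0.
have afn : approximable (fun x => Num.max (- f x) 0).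
  apply: part => [|x|x]; first by apply: measurable_maxr => //; exact: measurable_funN.
    by rewrite le_max lexx orbT.
  by case: (leP (- f x) 0) => h; rewrite ?expr0n ?sqr_ge0 ?sqrrN.
have [_] := approximableD _ _ afp (approximable_ratscale (- 1) _ afn).
rewrite (_ : _ \+ _ = f)//; apply/funext=> x /=.
rewrite rmorphN1 mulN1r; case: (leP (f x) 0) => h; case: (leP (- f x) 0) => h'; lra.
Qed.

End step_approximation.

(** * Square roots as limits of polynomial iterations *)

Section sqrt_iter.
Context {R : realType}.

(* Increases to the square root on [0, 1] using only sums and squares, the
   operations under which Borel fields are already known to be stable. *)
Fixpoint sqrt_iter (n : nat) (x : R) : R :=
  if n is n'.+1 then sqrt_iter n' x + (x - sqrt_iter n' x ^+ 2) / 2 else 0.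

(** With [s] the square root and [p] the current iterate, the next error is
    [(s - p) * (1 - (s + p) / 2)], and both factors are nonnegative as long as [p <= s <= 1]. *)
Lemma sqrt_iter_bound n x : 0 <= x <= 1 -> 0 <= sqrt_iter n x <= Num.sqrt x.
Proof.
move=> /andP[x0 x1]; have := sqr_sqrtr x0; have := sqrtr_ge0 x.
have : Num.sqrt x <= 1 by rewrite -sqrtr1 ler_wsqrtr.
move: (Num.sqrt x) => s s1 s0 sx; elim: n => [|n /= /andP[p0 ps]]; first by rewrite /= lexx.
by apply/andP; split; nra.
Qed.

(** Since [p] is nonnegative, the contraction factor [1 - (s + p) / 2] is at most [1 - s / 2]. *)
Lemma sqrt_iter_geometric n x : 0 <= x <= 1 ->
  Num.sqrt x - sqrt_iter n x <= (1 - Num.sqrt x / 2) ^+ n * Num.sqrt x.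
Proof.
move=> x01; have /andP[x0 x1] := x01; have := sqr_sqrtr x0; have := sqrtr_ge0 x.
have : Num.sqrt x <= 1 by rewrite -sqrtr1 ler_wsqrtr.
have := fun n => sqrt_iter_bound n x x01.
move: (Num.sqrt x) => s bnd s1 s0 sx; elim: n => [|n IH] /=.
  by rewrite subr0 expr0 mul1r.
have /andP[p0 ps] := bnd n.
apply: (@le_trans _ _ ((1 - s / 2) * (s - sqrt_iter n x))); first by nra.
by rewrite exprS -mulrA; apply: ler_wpM2l => //; lra.
Qed.

Lemma sqrt_iter_cvg x : 0 <= x <= 1 -> sqrt_iter n x @[n --> \oo] --> Num.sqrt x.
Proof.
move=> x01; have geo := fun n => sqrt_iter_geometric n x x01.
have bnd := fun n => sqrt_iter_bound n x x01.
have s0 := sqrtr_ge0 x.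
have s1 : Num.sqrt x <= 1 by case/andP: x01 => ? ?; rewrite -sqrtr1 ler_wsqrtr.
have gcvg : Num.sqrt x - geometric (Num.sqrt x) (1 - Num.sqrt x / 2) n @[n --> \oo]
    --> Num.sqrt x.
  (* At [0] the ratio of the geometric sequence is 1, and its vanishing comes from the factor
     [Num.sqrt x] instead. *)
  have [->|sN0] := eqVneq (Num.sqrt x) 0.
    apply: cvg_near_cst; exists 0%N => // n _ /=; by rewrite mul0r subr0.
  rewrite -[X in _ --> X]subr0; apply: cvgB; first exact: cvg_cst.
  apply: cvg_geometric; rewrite ltr_norml; have : 0 < Num.sqrt x by rewrite lt_neqAle eq_sym sN0.
  by move=> s0'; apply/andP; split; lra.
apply: (squeeze_cvgr _ gcvg (cvg_cst _)); near=> n.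
have /andP[_ ->] := bnd n; rewrite andbT /=.
by have := geo n; rewrite mulrC; lra.
Unshelve. all: by end_near. Qed.

Lemma measurable_sqrt : measurable_fun setT (@Num.sqrt R).
Proof. apply: continuous_measurable_fun; exact: sqrt_continuous. Qed.

(** On nonnegative reals, 0 included, the inverse is the power with exponent -1. *)
Lemma measurable_inv_ge0 d (T : measurableType d) (D : set T) (f : T -> R) :
  measurable_fun D f -> (forall x, D x -> 0 <= f x) -> measurable_fun D (fun x => (f x)^-1).
Proof.
move=> mf f0; apply: (eq_measurable_fun (fun x => f x `^ (- 1))).
  by move=> x /set_mem /f0 fx; rewrite powR_inv1.
by apply: (measurableT_comp (measurable_powR (- 1)) mf).
Qed.

End sqrt_iter.

(** [h] is bounded in absolute value by [1 + h ^+ 2], and constants are integrable for a finite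
    measure. *)
Lemma integrable_of_sqr {R : realType} d (T : measurableType d)
    (m : {finite_measure set T -> \bar R}) (h : T -> R) :
  measurable_fun setT h -> m.-integrable setT (fun x => ((h x) ^+ 2)%:E) ->
  m.-integrable setT (EFin \o h).
Proof.
move=> mh ih2; have i1 : m.-integrable setT (EFin \o (fun x => 1 + h x ^+ 2)).
  apply: (@integrableD _ _ _ _ _ measurableT (EFin \o cst 1)) ih2.
  exact: finite_measure_integrable_cst.
apply: le_integrable i1 => //; first exact/measurable_EFinP.
move=> x _; rewrite /= lee_fin [leRHS]ger0_norm ?addr_ge0 ?sqr_ge0//.
by rewrite ler_norml; apply/andP; split; nra.
Qed.

(** * Operations on Borel fields of functions *)

Section borel_field.
Context {R : realType} {d} {T : measurableType d} (e : nat -> set T).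
Hypothesis me : forall n, measurable (e n).
Hypothesis eI : setI_closed (range e).
Hypothesis e_gen : <<s range e >> = @measurable _ T.
Context {d'} {J : measurableType d'} (D : set J).
Hypothesis mD : measurable D.
Context (m : J -> {finite_measure set T -> \bar R}).
Implicit Types f g : J -> T -> R.

(** Measurability of a section of the field of spaces [L^2(m t)], tested against the fundamental
    sections given by the indicators of the sets [e n]. *)
Definition borel_field f := forall n,
  measurable_fun D (fun t => (\int[m t]_(x in e n) (f t x)%:E)%E).

Let L1 f := forall t, D t -> (m t).-integrable setT (EFin \o f t).

Let L1S f t A : L1 f -> D t -> measurable A -> (m t).-integrable A (EFin \o f t).
Proof. by move=> if1 Dt mA; apply: (integrableS measurableT) => //; exact: if1. Qed.

Lemma borel_fieldD f g : L1 f -> L1 g -> borel_field f -> borel_field g ->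
  borel_field (fun t x => f t x + g t x).
Proof.
move=> if1 ig1 bf bg n.
apply: (eq_measurable_fun (fun t => (\int[m t]_(x in e n) (f t x)%:E) +
   \int[m t]_(x in e n) (g t x)%:E)%E); last exact: emeasurable_funD.
move=> t /set_mem Dt; rewrite -integralD//; exact: L1S.
Qed.

Lemma borel_fieldZ (a : R) f : L1 f -> borel_field f ->
  borel_field (fun t x => a * f t x).
Proof.
move=> if1 bf n.
apply: (eq_measurable_fun (fun t => (a%:E * \int[m t]_(x in e n) (f t x)%:E)%E)).
  by move=> t /set_mem Dt; rewrite -integralZl//; exact: L1S.
exact: measurable_funeM.
Qed.

Lemma bounded_L1 (t : J) (h : T -> R) (M : R) : measurable_fun setT h ->
  (forall x, `|h x| <= M) -> (m t).-integrable setT (EFin \o h).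
Proof.
move=> mh hM; apply: measurable_bounded_integrable => //.
  by rewrite ltey_eq fin_num_measure.
by exists M; split; [exact: num_real|move=> M' MM' x _; exact: le_trans (hM x) (ltW MM')].
Qed.

Section energy.
Context (t : J) (h : T -> R).
Hypothesis mh : measurable_fun setT h.
Hypothesis ih2 : (m t).-integrable setT (fun x => ((h x) ^+ 2)%:E).

Let ih := integrable_of_sqr _ _ (m t) h mh ih2.

Let integrable_mul_step (k : T -> R) A l : measurable A ->
  (m t).-integrable A (EFin \o k) ->
  (m t).-integrable A (EFin \o (fun x => k x * step e l x)).
Proof.
move=> mA ik.
apply: (@integrableMl _ _ _ _ _ mA (EFin \o k) (step e l)) => //; first by apply: measurable_funTS; exact: measurable_step.
have [M M0 bM] := @step_bounded R _ _ e l.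
by exists M; split; [exact: num_real|move=> M' MM' x _; exact: le_trans (bM x) (ltW MM')].
Qed.

Let Rintegral_mul_step (k : T -> R) A l : measurable A ->
  (m t).-integrable A (EFin \o k) ->
  \int[m t]_(x in A) (k x * step e l x) =
  \sum_(p <- l) ratr p.1 * \int[m t]_(x in A `&` e p.2) k x.
Proof.
move=> mA ik; elim: l => [|p l IH].
  by rewrite big_nil -[RHS](Rintegral_set0 (m t) k) /Rintegral integral_set0 integral0_eq//
    => x _; rewrite /step big_nil mulr0.
have mk1 : (m t).-integrable A (EFin \o (fun x => k x * \1_(e p.2) x)).
  rewrite (_ : _ \o _ = (EFin \o k) \_ (e p.2)).
    by apply/integrable_restrict => //; apply: integrableS ik => //; exact: measurableI.
  by rewrite epatch_indic; apply/funext=> x /=; rewrite EFinM.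
rewrite big_cons -IH Rintegral_mkcondr patch_indic -RintegralZl//.
rewrite -RintegralD//; last 2 first.
- exact: (integrableZl mA (ratr p.1) mk1).
- exact: integrable_mul_step.
by apply: eq_Rintegral => x _ /=; rewrite /step big_cons mulrDr mulrCA.
Qed.

(* [2 <h, step e l> - |step e l|^2] in L^2(A, m t), expanded into integrals over
   sets of the ring; its supremum over [l] is the squared norm of [h]. *)
Definition energy (A : set T) (l : seq (rat * nat)) : R :=
  2 * (\sum_(p <- l) ratr p.1 * \int[m t]_(x in A `&` e p.2) h x) -
  \sum_(p <- l) ratr p.1 *
    (\sum_(p' <- l) ratr p'.1 * \int[m t]_(x in (A `&` e p.2) `&` e p'.2) 1).

Let iT (k : T -> R) A : measurable A -> (m t).-integrable setT (EFin \o k) ->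
  (m t).-integrable A (EFin \o k).
Proof. by move=> mA; apply: integrableS. Qed.

(** Completing the square: the defect of the energy from the squared norm of [h] is the squared
    distance from [h] to the step function. *)
Lemma energyE A l : measurable A ->
  \int[m t]_(x in A) (h x ^+ 2) - energy A l =
  \int[m t]_(x in A) ((h x - step e l x) ^+ 2).
Proof.
move=> mA; have ihA := iT _ _ mA ih.
have istep : (m t).-integrable setT (EFin \o step e l).
  have [M _ bM] := @step_bounded R _ _ e l.
  by apply: bounded_L1 bM; exact: measurable_step.
have i1 B : measurable B -> (m t).-integrable B (EFin \o cst 1).
  by move=> mB; exact: finite_measure_integrable_cst.
have E2 : \int[m t]_(x in A) (step e l x * step e l x) =
    \sum_(p <- l) ratr p.1 *
    (\sum_(p' <- l) ratr p'.1 * \int[m t]_(x in (A `&` e p.2) `&` e p'.2) 1).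
  rewrite Rintegral_mul_step//; last exact: iT.
  apply: eq_bigr => p _; congr (_ * _).
  have mAp : measurable (A `&` e p.2) by exact: measurableI.
  rewrite -(Rintegral_mul_step (cst 1))//; last exact: i1.
  by apply: eq_Rintegral => x _; rewrite /= mul1r.
rewrite /energy -E2 -(Rintegral_mul_step h)//.
have ihs := integrable_mul_step h A l mA ihA.
have iss := integrable_mul_step _ A l mA (iT _ _ mA istep).
have i2hs : (m t).-integrable A (EFin \o (fun x => 2 * (h x * step e l x))).
  exact: (integrableZl mA 2 ihs).
rewrite -RintegralZl// -RintegralB// -RintegralB//.
- by apply: eq_Rintegral => x _ /=; ring.
- exact: (iT (fun x => h x ^+ 2)).
- exact: (integrableB mA i2hs iss).
Qed.

(** By [energyE] no energy exceeds the squared norm, and density of the step functions makes it the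
    supremum. Here [esups _ 0] ranges over all codes of lists, codes of nothing being read as the
    empty list. *)
Lemma sqr_integral_sup n :
  (\int[m t]_(x in e n) ((h x) ^+ 2)%:E)%E =
  esups (fun k => (energy (e n) (odflt [::] (unpickle k)))%:E) 0%N.
Proof.
have mA := me n; have ih2A : (m t).-integrable (e n) (fun x => ((h x) ^+ 2)%:E).
  exact: iT (fun x => h x ^+ 2) _ mA ih2.
have fin := integrable_fin_num mA ih2A.
rewrite -(fineK fin); apply/eqP; rewrite eq_le; apply/andP; split.
- apply/lee_addgt0Pr => eps eps0.
  have [l lE] := @step_L2_dense R _ _ _ me eI e_gen (m t) (e n) (ex_intro2 _ _ n I erefl)
    h mh ih2A _ eps0.
  have El := energyE (e n) l mA.
  apply: (@le_trans _ _ ((energy (e n) l)%:E + eps%:E)%E).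
    rewrite -EFinD lee_fin -lerBlDl [leLHS]El -lee_fin; apply: (le_trans _ lE).
    rewrite /Rintegral fineK// ge0_fin_numE; first exact: le_lt_trans lE (ltry _).
    by apply: integral_ge0 => x _; rewrite lee_fin sqr_ge0.
  rewrite leeD2r//; apply: ereal_sup_ubound; exists (pickle l) => //.
  by rewrite pickleK.
- apply: ub_ereal_sup => _ [k _ <-]; rewrite lee_fin -subr_ge0 energyE//.
  by apply: Rintegral_ge0 => x _; exact: sqr_ge0.
Qed.

End energy.
Let measurable_Rintegral f A : range e A -> borel_field f ->
  measurable_fun D (fun t => \int[m t]_(x in A) f t x).
Proof.
by move=> [n _ <-] bf; apply: (measurableT_comp (@fine_measurable R setT measurableT)).
Qed.

(** Each energy is a polynomial in integrals of [f t] and of 1 over finite intersections of sets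
    [e n], which belong to the sequence again; the integral of the square is their countable
    supremum. *)
Lemma borel_field_sqr f :
  (forall t, D t -> measurable_fun setT (f t)) ->
  (forall t, D t -> (m t).-integrable setT (fun x => ((f t x) ^+ 2)%:E)) ->
  borel_field (fun _ _ => 1) -> borel_field f ->
  borel_field (fun t x => f t x ^+ 2).
Proof.
move=> mf if2 b1 bf n.
apply: (eq_measurable_fun (fun t =>
  esups (fun k => (energy t (f t) (e n) (odflt [::] (unpickle k)))%:E) 0%N)).
  by move=> t /set_mem Dt; rewrite [RHS]sqr_integral_sup//; [exact: mf|exact: if2].
have en : range e (e n) by exists n.
have ep p : range e (e p) by exists p.
apply: measurable_fun_esups => k; apply/measurable_EFinP.
apply: measurable_funB.
  apply: measurable_funM => //; apply: measurable_sum => p; apply: measurable_funM => //.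
  by apply: measurable_Rintegral => //; exact: eI.
apply: measurable_sum => p; apply: measurable_funM => //.
apply: measurable_sum => p'; apply: measurable_funM => //.
by apply: (measurable_Rintegral (fun _ _ => 1)) => //; do 2 apply: eI => //.
Qed.

(** Each iterate of [sqrt_iter] is a Borel field by induction, using sums, multiples and
    [borel_field_sqr]. The iterates stay in [[0, 1]], so dominated convergence passes the property
    to the limit. *)
Lemma borel_field_sqrt f :
  (forall t, D t -> measurable_fun setT (f t)) ->
  (forall t x, D t -> 0 <= f t x <= 1) ->
  borel_field (fun _ _ => 1) -> borel_field f ->
  borel_field (fun t x => Num.sqrt (f t x)).
Proof.
move=> mf f01 b1 bf.
have miter n t : D t -> measurable_fun setT (fun x => sqrt_iter n (f t x)).
  move=> Dt; elim: n => [|n IH] /=; first exact: measurable_cst.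
  apply: measurable_funD => //; apply: measurable_funM => //.
  by apply: measurable_funB; [exact: mf|exact: measurable_funX].
have sqrt1 t x : D t -> Num.sqrt (f t x) <= 1.
  by move=> Dt; have /andP[_ f1] := f01 t x Dt; rewrite -sqrtr1 ler_wsqrtr.
have iter1 n t x : D t -> `|sqrt_iter n (f t x)| <= 1.
  move=> Dt; have /andP[p0 ps] := sqrt_iter_bound n _ (f01 t x Dt).
  by rewrite ger0_norm// (le_trans ps)// sqrt1.
have L1iter n : L1 (fun t x => sqrt_iter n (f t x)).
  by move=> t Dt; apply: (bounded_L1 _ _ 1) => [|x]; [exact: miter|exact: iter1].
have iter2 n t x : D t -> `|sqrt_iter n (f t x) ^+ 2| <= 1.
  by move=> Dt; rewrite normrX exprn_ile1// iter1.
have L1iter2 n : L1 (fun t x => sqrt_iter n (f t x) ^+ 2).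
  move=> t Dt; apply: (bounded_L1 _ _ 1) => [|x]; last exact: iter2.
  by apply: measurable_funX; exact: miter.
have L1f : L1 f.
  move=> t Dt; apply: (bounded_L1 _ _ 1) => [|x]; first exact: mf.
  by have /andP[f0 f1] := f01 t x Dt; rewrite ger0_norm.
have L1d n : L1 (fun t x => f t x + -1 * sqrt_iter n (f t x) ^+ 2).
  move=> t Dt; apply: (bounded_L1 _ _ 2) => [|x].
    by apply: measurable_funD; [exact: mf|apply: measurable_funM => //; apply: measurable_funX; exact: miter].
  have /andP[f0 f1] := f01 t x Dt; have := iter2 n t x Dt.
  by move=> h2; apply: (le_trans (ler_normD _ _)); rewrite ger0_norm// mulN1r normrN; lra.
have biter n : borel_field (fun t x => sqrt_iter n (f t x)).
  elim: n => [|n IH].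
    move=> k; apply: (eq_measurable_fun (cst 0%E)) => //.
    by move=> t _; rewrite /= integral0.
  have := borel_fieldD _ (fun t x => 2^-1 * (f t x + -1 * sqrt_iter n (f t x) ^+ 2))
    (L1iter n) _ IH.
  have -> : (fun t x => sqrt_iter n.+1 (f t x)) = (fun t x => sqrt_iter n (f t x) +
      2^-1 * (f t x + -1 * sqrt_iter n (f t x) ^+ 2)).
    by apply/funext=> t; apply/funext=> x /=; rewrite mulN1r mulrC.
  apply.
    move=> t Dt; exact: (integrableZl measurableT 2^-1 (L1d n t Dt)).
  apply: borel_fieldZ => //; apply: borel_fieldD => //.
    move=> t Dt; exact: (integrableZl measurableT (-1) (L1iter2 n t Dt)).
  by apply: borel_fieldZ => //; apply: borel_field_sqr => // t Dt; [exact: miter|exact: L1iter2].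
move=> k; apply: (emeasurable_fun_cvg
  (fun n t => (\int[m t]_(x in e k) (sqrt_iter n (f t x))%:E)%E)) => [n|t Dt].
  exact: biter.
apply: (@dominated_cvg _ _ _ (m t) (e k) (me k) _ _ (EFin \o cst 1)) => //.
- by move=> n; apply/measurable_EFinP; apply: measurable_funTS; exact: miter.
- move=> x _; apply/fine_cvgP; split; first by near=> n.
  by apply: sqrt_iter_cvg; exact: f01.
- exact: finite_measure_integrable_cst.
- by move=> n x _; rewrite /= lee_fin iter1.
Unshelve. all: by end_near. Qed.

End borel_field.

(** * Factorizing families *)

Lemma countable_range {T : Type} (A : set T) : countable A -> A !=set0 ->
  exists e : nat -> T, range e = A.
Proof.
move=> /countable_injP[f finj] [a Aa].
(* An integer that codes no element of [A] is sent to the default [a]. *)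
have ex n : exists b, A b /\ forall b', A b' -> f b' = n -> b = b'.
  have [[b [Ab fb]]|nb] := pselect (exists b, A b /\ f b = n).
    by exists b; split=> // b' Ab' fb'; apply: finj; rewrite ?inE// fb fb'.
  by exists a; split=> // b' Ab' fb'; case: nb; exists b'.
have [e eA] := choice ex; exists e; apply/seteqP; split=> [_ [n _ <-]|b Ab].
  by case: (eA n).
by exists (f b) => //; case: (eA (f b)) => _; apply.
Qed.

Lemma exists_density {R : realType} d (T : measurableType d) (m n : probability T R) :
  n `<< m -> exists h : T -> R, [/\ measurable_fun setT h, (forall x, 0 <= h x) &
    forall A, measurable A -> n A = (\int[m]_(x in A) (h x)%:E)%E].
Proof.
move=> nm; pose f := Radon_Nikodym_SigmaFinite.f n m.
have ffin : forall x, f x \is a fin_num := Radon_Nikodym_SigmaFinite.f_fin_num nm.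
have mf : measurable_fun setT f.
  exact: measurable_int (Radon_Nikodym_SigmaFinite.f_integrable nm).
exists (fun x => fine (f x)); split.
- by apply: (measurableT_comp (@fine_measurable R setT measurableT)).
- by move=> x; apply: fine_ge0; exact: Radon_Nikodym_SigmaFinite.f_ge0 nm x.
- move=> A mA; rewrite (Radon_Nikodym_SigmaFinite.f_integral nm)//.
  by apply: eq_integral => x _; rewrite fineK.
Qed.

(* A multiplicative obstruction that occurs at one time occurs at all times:
   it propagates to larger times by splitting, and to smaller ones by halving. *)
Lemma additive_never {R : realType} (P : R -> Prop) :
  (forall s t, 0 < s -> 0 < t -> P (s + t) <-> P s \/ P t) ->
  (exists2 t, 0 < t & ~ P t) -> forall t, 0 < t -> ~ P t.
Proof.
move=> PD [t0 t00 Pt0] t tp Pt.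
have half n : P (t * (2^-1) ^+ n).
  elim: n => [|n IH]; first by rewrite expr0 mulr1.
  have pos : 0 < t * 2^-1 ^+ n.+1 by rewrite mulr_gt0// exprn_gt0.
  have [] // := (PD _ _ pos pos).1.
  rewrite (_ : _ + _ = t * 2^-1 ^+ n)//.
  by rewrite exprS; field.
(* Once [t / 2 ^ n] is below [t0], the time [t0] splits with [t / 2 ^ n] as one summand, and [P]
   would hold at [t0]. *)
have : geometric t (2^-1 : R) n @[n --> \oo] --> 0.
  by apply: cvg_geometric; rewrite ger0_norm//; lra.
move=> /cvgrPdist_lt /(_ _ t00)[n _ /(_ n (leqnn n))] /=.
rewrite sub0r normrN ger0_norm; last by rewrite mulr_ge0 ?exprn_ge0// ltW.
move=> lt; apply: Pt0; rewrite -(subrK (t * 2^-1 ^+ n) t0).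
apply/PD; first by rewrite subr_gt0.
  by rewrite mulr_gt0// exprn_gt0.
by right.
Qed.

(** * Change of variables, mass of the empty set, and exhaustion by the ring *)

Section factorizing.
Context {R : realType} {L : topologicalType}.
Hypothesis L_hausdorff : hausdorff_space L.
Hypothesis L_locally_compact : locally_compact [set: L].
Hypothesis L_second_countable : @second_countable L.
Context (mu : forall t : R, probability (@Ct R L t) R).
Context (Rr : set (set (@Ct R L 1))) (Delta : R -> R -> @Ct R L 1 -> R).
Hypothesis hmu : measurable_factorizing_family mu Rr Delta.

Let moplus s t (s0 : 0 < s) (t0 : 0 < t) : measurable_fun setT (@oplus R L s t) :=
  measurable_oplus L_hausdorff L_locally_compact L_second_countable s t s0 t0.
Let msigmat t (t0 : 0 < t) : measurable_fun setT (@sigmat R L t) :=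
  measurable_sigmat L_hausdorff L_locally_compact L_second_countable t t0.
Let munsigmat t (t0 : 0 < t) : measurable_fun setT (@unsigmat R L t) :=
  measurable_unsigmat L_hausdorff L_locally_compact L_second_countable t t0.
Let mlpart s t (s0 : 0 < s) : measurable_fun setT (@lpart R L s t) :=
  measurable_lpart L_hausdorff L_locally_compact L_second_countable s t s0.
Let mrpart s t : measurable_fun setT (@rpart R L s t) :=
  measurable_rpart L_hausdorff L_locally_compact L_second_countable s t.
Let mhit t r : measurable [set Z : @Ct R L t | exists l, proj1_sig Z (r, l)] :=
  measurable_hit_slice L_hausdorff L_locally_compact L_second_countable t r.
Let mempty t : measurable [set CtT0 t : @Ct R L t] :=
  measurable_empty L_hausdorff L_locally_compact L_second_countable t.

Lemma measurable_Delta s t : 0 < s -> 0 < t ->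
  measurable_fun setT (fun Z => Delta s t (@sigmat R L (s + t) Z)).
Proof.
move=> s0 t0; case: hmu => _ _ _ _ [mD _ _].
apply: (@measurable_comp _ _ _ (@Ct R L (s + t)) ((R * R) * @Ct R L 1)%type R _
  (fun p => Delta p.1.1 p.1.2 p.2) setT (fun Z => ((s, t), @sigmat R L (s + t) Z))
  _ _ mD).
- by apply: measurableX => //; apply: measurableX; exact: measurable_itv.
- by move=> _ [Z _ <-]; do 2 split => //=; rewrite in_itv/= andbT.
- apply: measurable_fun_pair; first exact: measurable_cst.
  by apply: msigmat; exact: addr_gt0.
Qed.

(** The exceptional pairs have a first set hitting the slice at [s] or a second set hitting the
    slice at [0]; both events are null by condition (ii). *)
Lemma ae_parts_oplus s t : 0 < s -> 0 < t ->
  {ae (mu s \x mu t)%E, forall z, lpart s t (oplus s t z) = z.1 /\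
                                  rpart s t (oplus s t z) = z.2}.
Proof.
move=> s0 t0; case: hmu => _ slice0 _ _ _.
pose N1 := [set Z : @Ct R L s | exists l, proj1_sig Z (s, l)].
pose N2 := [set Z : @Ct R L t | exists l, proj1_sig Z (0, l)].
exists ((N1 `*` setT) `|` (setT `*` N2)); split.
- by apply: measurableU; apply: measurableX => //; exact: mhit.
- apply/negligibleP; first by apply: measurableU; apply: measurableX => //; exact: mhit.
  apply: negligibleU; apply/negligibleP; try by apply: measurableX => //; exact: mhit.
    transitivity (mu s N1 * mu t setT)%E.
      by apply: product_measure1E => //; exact: mhit.
    by rewrite slice0 ?mul0e// ltW//=.
  transitivity (mu s setT * mu t N2)%E.
    by apply: product_measure1E => //; exact: mhit.
  by rewrite slice0 ?mule0// lexx ltW.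
- move=> [Z1 Z2] /= nE; have [l1|n1] := pselect (N1 Z1); first by left.
  right; split=> //; apply: contrapT => n2; apply: nE; split.
    exact: lpart_oplus.
  exact: rpart_oplus.
Qed.

(** As [Delta] is the density of the law [Q] of the union, the left side is an integral against [Q].
    Pulled back along [oplus], the two parts become the two coordinates almost everywhere. *)
Lemma parts_integral s t (f : @Ct R L s -> R) (g : @Ct R L t -> R)
    (A : set (@Ct R L (s + t))) : 0 < s -> 0 < t ->
  measurable_fun setT f -> measurable_fun setT g ->
  (forall Z, 0 <= f Z) -> (forall Z, 0 <= g Z) -> measurable A ->
  (\int[mu (s + t)%R]_(Z in A)
     (f (lpart s t Z) * g (rpart s t Z) * Delta s t (@sigmat R L (s + t)%R Z))%:E)%E =
  (\int[mu s \x mu t]_(z in oplus s t @^-1` A) (f z.1 * g z.2)%:E)%E.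
Proof.
move=> s0 t0 mf mg f0 g0 mA; case: (hmu) => _ _ _ _ [_ Dpos DE].
have mo := moplus s t s0 t0.
have [Q QE] := pushforward_probability _ _ _ _ (mu s \x mu t)%E _ mo.
pose F Z := (f (lpart s t Z) * g (rpart s t Z))%:E.
have mF : measurable_fun setT F.
  apply/measurable_EFinP; apply: measurable_funM.
    by apply: (measurableT_comp mf); exact: mlpart.
  by apply: (measurableT_comp mg); exact: mrpart.
have F0 Z : (0 <= F Z)%E by rewrite lee_fin mulr_ge0.
transitivity (\int[Q]_(Z in A) F Z)%E.
  rewrite (density_integral _ _ (mu (s + t)) Q _ (measurable_Delta s t s0 t0))//.
  by move=> B mB; rewrite -DE//; exact: (congr1 (fun q => q B) QE).
rewrite (congr1 (fun q => integral q A F) QE) (ge0_integral_pushforward mo)//; last 2 first.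
- exact: measurable_funTS.
- by move=> Z _; exact: F0.
have mA' : measurable (oplus s t @^-1` A).
  by rewrite -[X in measurable X]setTI; exact: mo.
apply: ae_eq_integral => //.
- by apply: measurable_funTS; exact: measurableT_comp.
- apply: measurable_funTS; apply/measurable_EFinP.
  by apply: measurable_funM; exact: measurableT_comp.
- by apply: filterS (ae_parts_oplus s t s0 t0) => z [h1 h2] _; rewrite /F/= h1 h2.
Qed.

Lemma oplus_preimage_empty s t : 0 < s -> 0 < t ->
  @oplus R L s t @^-1` [set CtT0 (s + t)] = [set CtT0 s] `*` [set CtT0 t].
Proof.
move=> s0 t0; apply/seteqP; split=> [[Z1 Z2] /= E|[Z1 Z2] [/= -> ->]]; last first.
  by apply: Ct_inj; rewrite proj1_oplus//= set0U -subset0 => x /shift_mem.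
have E' := proj1_oplus s t (Z1, Z2) s0 t0; rewrite E /= in E'.
split; apply: Ct_inj => /=; rewrite -subset0 => x Zx.
  by have : set0 x by rewrite [set0]E'; left.
have : set0 (x.1 + s, x.2) by rewrite [set0]E'; right; apply/shift_mem; rewrite /= addrK; case: x Zx.
by [].
Qed.

(** The law of the union gives the empty set the product of the two masses, and it has the same null
    sets as [mu (s + t)]. This is the form required by [additive_never]. *)
Lemma empty_null_additive s t : 0 < s -> 0 < t ->
  mu (s + t) [set CtT0 (s + t)] = 0%E <->
  mu s [set CtT0 s] = 0%E \/ mu t [set CtT0 t] = 0%E.
Proof.
move=> s0 t0; case: (hmu) => /(_ _ _ s0 t0)[pmu mup] _ _ _ _.
have pE : pushforward (mu s \x mu t)%E (@oplus R L s t) [set CtT0 (s + t)] =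
    (mu s [set CtT0 s] * mu t [set CtT0 t])%E.
  rewrite /pushforward oplus_preimage_empty//.
  by apply: product_measure1E; exact: mempty.
have null0 : (mu s [set CtT0 s] * mu t [set CtT0 t] = 0)%E <->
    mu s [set CtT0 s] = 0%E \/ mu t [set CtT0 t] = 0%E.
  by split=> [/eqP|[]->]; rewrite ?mul0e ?mule0// mule_eq0 => /orP[]/eqP; [left|right].
apply: (iff_trans _ null0); rewrite -pE; split=> h.
  apply: (pmu [set CtT0 (s + t)]); [|exact: mempty|exact: subset_refl].
  by apply/measure0_null_setP; [exact: mempty|].
apply: (mup [set CtT0 (s + t)]); [|exact: mempty|exact: subset_refl].
by move=> A mA /subset_set1[->|->//]; rewrite /pushforward preimage_set0 measure0.
Qed.

(** Puts all the rescaled measures on C_1 as bundled probabilities; nonpositive times receive the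
    default [mu 1]. *)
Lemma exists_rescaled : exists m : R -> probability (@Ct R L 1) R,
  forall t, 0 < t -> m t = pushforward (mu t) (@sigmat R L t) :> (set _ -> \bar R).
Proof.
suff H t : exists q : probability (@Ct R L 1) R,
    0 < t -> q = pushforward (mu t) (@sigmat R L t) :> (set _ -> \bar R).
  by have [m mE] := choice H; exists m.
have [t0|t0] := boolP (0 < t); last by exists (mu 1).
by have [q qE] := pushforward_probability _ _ _ _ (mu t) _ (msigmat t t0); exists q.
Qed.

Lemma rescaled_integral t (q : probability (@Ct R L 1) R) (B : set (@Ct R L 1))
    (F : @Ct R L 1 -> R) : 0 < t ->
  q = pushforward (mu t) (@sigmat R L t) :> (set _ -> \bar R) ->
  measurable B -> measurable_fun setT F -> (forall W, 0 <= F W) ->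
  (\int[q]_(W in B) (F W)%:E =
   \int[mu t]_(Z in @sigmat R L t @^-1` B) (F (sigmat t Z))%:E)%E.
Proof.
move=> t0 qE mB mF F0; rewrite (congr1 (fun q => integral q B _) qE).
rewrite (ge0_integral_pushforward (msigmat t t0))//.
- by apply/measurable_EFinP; exact: measurable_funTS.
- by move=> W _; rewrite lee_fin.
Qed.

Lemma ring_setI : setI_closed Rr.
Proof.
case: hmu => _ _ _ [_ [_ _ RD] _ _ _] _ A B rA rB.
by rewrite -setDD; exact: (RD _ _ rA (RD _ _ rA rB)).
Qed.

Lemma exists_ring_sequence : exists e : nat -> set (@Ct R L 1), range e = Rr.
Proof.
by case: hmu => _ _ _ [cR [R0 _ _] _ _ _] _; apply: countable_range => //; exists set0.
Qed.

Lemma exists_ring_exhaustion : exists E : nat -> set (@Ct R L 1),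
  [/\ (forall n, Rr (E n)), {homo E : m n / (m <= n)%N >-> (m <= n)%O} &
      \bigcup_n E n = \bigcup_(A in Rr) A].
Proof.
have [e eE] := exists_ring_sequence.
case: hmu => _ _ _ [_ [R0 RU _] _ _ _] _.
exists (fun n => \bigcup_(i in `I_n) e i); split.
- elim=> [|n IH]; first by rewrite II0 bigcup_set0.
  rewrite IIS bigcup_setU bigcup_set1; apply: RU => //.
  by rewrite -eE; exists n.
- move=> a b ab; apply/subsetPset; apply: bigcup_subset => k /= ka.
  exact: leq_trans ka ab.
- apply/seteqP; split=> [x [n _ [k _ ek]]|x [A]].
    by exists (e k) => //; rewrite -eE; exists k.
  by rewrite -eE => -[k _ <-] ekx; exists k.+1 => //; exists k => //=.
Qed.

(* The ring need not cover [C_1], but the complement of its union is an atom of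
   the sigma-algebra, hence contains at most one closed set. *)
Lemma uncovered_atom (B : set (@Ct R L 1)) : measurable B ->
  ~` (\bigcup_(A in Rr) A) `<=` B \/ ~` (\bigcup_(A in Rr) A) `<=` ~` B.
Proof.
case: hmu => _ _ _ [_ _ _ gR _] _; rewrite -[in measurable B]gR.
set U := ~` _; move: B.
apply: (@smallest_sub _ _ _ [set B | U `<=` B \/ U `<=` ~` B]).
  split=> /=.
  - by right=> x _.
  - by move=> A [UA|UA]; [right=> x /UA h [_]|left=> x /UA].
  - move=> F UF; have [[n Un]|h] := pselect (exists n, U `<=` F n).
      by left=> x /Un Fx; exists n.
    right=> x Ux [n _ Fx]; case: (UF n) => [Un|/(_ x Ux)//].
    by apply: h; exists n.
by move=> A RA; right=> x Ux Ax; apply: Ux; exists A.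
Qed.

(** By [uncovered_atom] the uncovered part is inseparable from any of its points [p]. If [p] is
    empty, the preimage lies in the singleton of the empty set, null by hypothesis; otherwise [p]
    meets a slice at some [r], and the preimage lies in the null event of hitting the slice at
    [r * t]. *)
Lemma uncovered_null t : 0 < t -> mu t [set CtT0 t] = 0%E ->
  mu t (@sigmat R L t @^-1` ~` (\bigcup_(A in Rr) A)) = 0%E.
Proof.
move=> t0 empty0; case: (hmu) => _ slice0 _ [cR _ mR _ _] _.
set U := ~` _.
have mU : measurable (@sigmat R L t @^-1` U).
  rewrite -[X in measurable X]setTI; apply: msigmat => //; apply: measurableC.
  have [e eE] := exists_ring_sequence; rewrite -eE bigcup_image.
  apply: bigcup_measurable => n _; apply: mR; rewrite -eE; by exists n.
have null (N : set (@Ct R L t)) : measurable N -> mu t N = 0%E ->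
    @sigmat R L t @^-1` U `<=` N -> mu t (@sigmat R L t @^-1` U) = 0%E.
  by move=> mN N0 UN; apply: subset_measure0 UN N0.
have [[p Up]|nU] := pselect (exists p, U p); last first.
  by apply: (null set0) => // Z UZ; case: nU; exists (sigmat t Z).
have [p0|/eqP/set0P[[r l] pr]] := pselect (proj1_sig p = set0).
- apply: (null [set CtT0 t]) => // Z /= UZ; apply: Ct_inj => /=.
  have [|/(_ p Up)//] := uncovered_atom _ (mempty 1).
    move=> /(_ _ UZ) /= E; have := proj1_sigmat t Z t0; rewrite E /= => E'.
    rewrite -subset0 => x Zx; have : set0 (affine1 t^-1 0 x) by rewrite [set0]E'; exists x.
    by [].
  by case; apply: Ct_inj.
- have /= /andP[r0 r1] := Ct_sub _ _ _ pr.
  apply: (null [set Z | exists l, proj1_sig Z (r * t, l)]).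
  + exact: mhit.
  + by apply: slice0 => //; rewrite mulr_ge0 ?(ltW t0)//= ger_pMl.
  + move=> Z UZ; have [/(_ _ UZ)[l' /=]|/(_ p Up)[]] := uncovered_atom _ (mhit 1 r).
      rewrite proj1_sigmat// => -[[r' l''] Zr [<- _]]; exists l''.
      by rewrite addr0 mulrAC mulVf ?mul1r// gt_eqF.
    by exists l.
Qed.

End factorizing.

(** * The square root of the density is a unit *)

Section unit_of_factorizing.
Context {R : realType} {L : topologicalType}.
Hypothesis L_hausdorff : hausdorff_space L.
Hypothesis L_locally_compact : locally_compact [set: L].
Hypothesis L_second_countable : @second_countable L.
Context (mu : forall t : R, probability (@Ct R L t) R).
Context (Rr : set (set (@Ct R L 1))) (Delta : R -> R -> @Ct R L 1 -> R).
Hypothesis hmu : measurable_factorizing_family mu Rr Delta.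
Context (nu : forall t : R, probability (@Ct R L t) R) (h : forall t : R, @Ct R L t -> R).
Arguments h : clear implicits.
Hypothesis mh : forall t, 0 < t -> measurable_fun setT (h t).
Hypothesis h0 : forall t Z, 0 <= h t Z.
Hypothesis hE : forall t A, 0 < t -> measurable A ->
  nu t A = (\int[mu t]_(Z in A) (h t Z)%:E)%E.
Hypothesis nu_borel : forall A, Rr A ->
  measurable_fun (`]0, +oo[%classic : set R)
    (fun t : R => pushforward (nu t) (@sigmat R L t) A).
Hypothesis nu_conv : forall s t : R, 0 < s -> 0 < t ->
  forall A : set (@Ct R L (s + t)), measurable A ->
  nu (s + t) A = pushforward (nu s \x nu t)%E (@oplus R L s t) A.

Let msigmat t (t0 : 0 < t) : measurable_fun setT (@sigmat R L t) :=
  measurable_sigmat L_hausdorff L_locally_compact L_second_countable t t0.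
Let munsigmat t (t0 : 0 < t) : measurable_fun setT (@unsigmat R L t) :=
  measurable_unsigmat L_hausdorff L_locally_compact L_second_countable t t0.

Lemma sqrt_density_borel A : Rr A ->
  measurable_fun (`]0, +oo[%classic : set R) (fun t : R =>
    (\int[mu t]_(Z in @sigmat R L t @^-1` A) (Num.sqrt (h t Z))%:E)%E).
Proof.
move=> RA; have [m mE] := exists_rescaled L_hausdorff L_locally_compact L_second_countable mu.
have [e eE] := exists_ring_sequence mu Rr Delta hmu.
have rI := ring_setI mu Rr Delta hmu.
case: (hmu) => _ _ _ [_ _ mR gR bR] _.
have me n : measurable (e n) by apply: mR; rewrite -eE; exists n.
pose H t W := h t (unsigmat t W).
have mH t : 0 < t -> measurable_fun setT (H t).
  by move=> t0; apply: measurableT_comp; [exact: mh|exact: munsigmat].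
have rescale t B (F : @Ct R L 1 -> R) (t0 : 0 < t) :=
  rescaled_integral L_hausdorff L_locally_compact L_second_countable mu t (m t) B F t0 (mE t t0).
have msig t B : 0 < t -> measurable B -> measurable (@sigmat R L t @^-1` B).
  by move=> t0 mB; rewrite -[X in measurable X]setTI; exact: msigmat.
have Hint t B : 0 < t -> measurable B ->
    (\int[m t]_(W in B) (H t W)%:E = pushforward (nu t) (@sigmat R L t) B)%E.
  move=> t0 mB; rewrite rescale//; [|exact: mH|by move=> W; exact: h0].
  rewrite /pushforward hE//; last exact: msig.
  by apply: eq_integral => Z _; rewrite /H sigmatK.
have H1int t B : 0 < t -> measurable B ->
    (\int[m t]_(W in B) (1 + H t W)%:E = pushforward (mu t) (@sigmat R L t) B +
     pushforward (nu t) (@sigmat R L t) B)%E.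
  move=> t0 mB; rewrite -Hint//.
  have -> : pushforward (mu t) (@sigmat R L t) B = (\int[m t]_(W in B) (cst 1%:E) W)%E.
    by rewrite integral_cst// mul1e; rewrite -(congr1 (fun q => q B) (mE t t0)).
  rewrite -ge0_integralD//; last 2 first.
  - by move=> W _; rewrite lee_fin h0.
  - by apply/measurable_EFinP; apply: measurable_funTS; exact: mH.
(* The reference measure: the sum of the rescaled [mu t] and [nu t], introduced through its density
   [1 + H t]. *)
have [m' m'E] : exists m' : R -> {finite_measure set (@Ct R L 1) -> \bar R},
    forall t, 0 < t -> forall B, m' t B = (\int[m t]_(W in B) (1 + H t W)%:E)%E.
  suff ex t : exists q : {finite_measure set (@Ct R L 1) -> \bar R},
      0 < t -> forall B, q B = (\int[m t]_(W in B) (1 + H t W)%:E)%E.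
    by have [m' m'E] := choice ex; exists m'.
  have [t0|t0] := boolP (0 < t); last by exists (mu 1).
  have [|||q qE] := density_finite_measure _ _ (m t) (fun W => 1 + H t W).
  - by apply: measurable_funD => //; exact: mH.
  - by move=> W; rewrite addr_ge0 ?h0.
  - rewrite H1int// /pushforward preimage_setT.
    by rewrite !probability_setT ltry.
  - by exists q => _ B; exact: (congr1 (fun q => q B) qE).
(* The density of the rescaled [nu t] with respect to [m' t], which takes values in [[0, 1]], unlike
   [H t]. *)
pose k t W := H t W / (1 + H t W).
have mk t : 0 < t -> measurable_fun setT (k t).
  move=> t0; apply: measurable_funM; first exact: mH.
  apply: measurable_inv_ge0; first by apply: measurable_funD => //; exact: mH.
  by move=> W _; rewrite addr_ge0 ?h0.
have H1 t W : 0 < 1 + H t W by rewrite ltr_pwDl ?h0.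
have k01 t W : 0 <= k t W <= 1.
  by rewrite divr_ge0 ?h0 ?(ltW (H1 t W))//= ler_pdivrMr// mul1r; lra.
have m'int t B (F : @Ct R L 1 -> R) : 0 < t -> measurable B ->
    measurable_fun setT F -> (forall W, 0 <= F W) ->
    (\int[m' t]_(W in B) (F W)%:E = \int[m t]_(W in B) (F W * (1 + H t W))%:E)%E.
  move=> t0 mB mF F0.
  rewrite (density_integral _ _ (m t) (m' t) (fun W => 1 + H t W))//.
  - by apply: measurable_funD => //; exact: mH.
  - by move=> C mC; exact: m'E.
  - exact/measurable_EFinP.
have pos t : (`]0, +oo[%classic : set R) t -> 0 < t by rewrite /= in_itv/= andbT.
have mD : measurable (`]0, +oo[%classic : set R) by exact: measurable_itv.
have bsum n : measurable_fun (`]0, +oo[%classic : set R)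
    (fun t => pushforward (mu t) (@sigmat R L t) (e n) +
       pushforward (nu t) (@sigmat R L t) (e n))%E.
  by apply: emeasurable_funD; [apply: bR|apply: nu_borel]; rewrite -eE; exists n.
have b1 : borel_field e (`]0, +oo[%classic : set R) m' (fun _ _ => 1).
  move=> n; apply: eq_measurable_fun (bsum n) => t /set_mem /pos t0.
  rewrite -H1int// -m'E//; rewrite integral_cst// mul1e//.
have bk : borel_field e (`]0, +oo[%classic : set R) m' k.
  move=> n; apply: eq_measurable_fun (nu_borel (e n) _); last by rewrite -eE; exists n.
  move=> t /set_mem /pos t0; rewrite -Hint// m'int//; [|exact: mk|by move=> W; case/andP: (k01 t W)].
  by apply: eq_integral => W _; rewrite /k divfK// gt_eqF.
have L1k t : 0 < t -> (m' t).-integrable setT (EFin \o k t).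
  move=> t0; apply: (bounded_L1 _ _ _ 1) => [|W]; first exact: mk.
  by have /andP[k0 k1] := k01 t W; rewrite ger0_norm.
have L1k2 t : 0 < t -> (m' t).-integrable setT (EFin \o (fun W => k t W ^+ 2)).
  move=> t0; apply: (bounded_L1 _ _ _ 1) => [|W]; first by apply: measurable_funX; exact: mk.
  by have /andP[k0 k1] := k01 t W; rewrite normrX exprn_ile1// ger0_norm.
have eI : setI_closed (range e) by rewrite eE.
have eg : <<s range e >> = @measurable _ (@Ct R L 1) by rewrite eE.
(* This is [k (1 - k) = H / (1 + H) ^+ 2]; its square root times the density [1 + H] of [m' t] is
   the square root of [H]. *)
have bkk : borel_field e (`]0, +oo[%classic : set R) m' (fun t W => k t W + -1 * k t W ^+ 2).
  apply: borel_fieldD => //.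
  - by move=> t /pos t0; exact: L1k.
  - by move=> t /pos t0; exact: (integrableZl measurableT (-1) (L1k2 t t0)).
  - apply: borel_fieldZ => //; first by move=> t /pos t0; exact: L1k2.
    by apply: borel_field_sqr => // t /pos t0; [exact: mk|exact: L1k2].
have [n _ enA] : range e A by rewrite eE.
have := borel_field_sqrt e me eI eg _ m' _ _ _ b1 bkk.
move=> /(_ _ _ n); rewrite enA => bs.
apply: (eq_measurable_fun _ _ (bs _ _)).
- move=> t /set_mem /pos t0; have mA : measurable A by exact: mR.
  rewrite m'int//; last first.
    apply: (measurableT_comp measurable_sqrt).
    apply: measurable_funD; first exact: mk.
    by apply: measurable_funM => //; apply: measurable_funX; exact: mk.
  transitivity (\int[m t]_(W in A) (Num.sqrt (H t W))%:E)%E.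
    apply: eq_integral => W _; congr EFin.
    rewrite (_ : k t W + -1 * k t W ^+ 2 = H t W / (1 + H t W) ^+ 2); last first.
      by rewrite /k; field; rewrite gt_eqF.
    rewrite sqrtrM; last exact: h0.
    rewrite sqrtrV ?sqr_ge0// sqrtr_sqr ger0_norm; last exact: ltW.
    by rewrite divfK// gt_eqF.
  rewrite rescale//; last by apply: (measurableT_comp measurable_sqrt); exact: mH.
  by apply: eq_integral => Z _; rewrite /H sigmatK.
- move=> t /pos t0; apply: measurable_funD; first exact: mk.
  by apply: measurable_funM => //; apply: measurable_funX; exact: mk.
- by move=> t W _; have /andP[k0 k1] := k01 t W; apply/andP; split; nra.
Qed.

(** Both sides have the same integrals over measurable sets: the left gives [nu (s + t)], the right
    gives the law of the union under [nu s \x nu t] by [parts_integral] and [product_density]. *)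
Lemma density_parts s t : 0 < s -> 0 < t ->
  {ae mu (s + t), forall Z, h (s + t) Z =
    Delta s t (@sigmat R L (s + t) Z) * h s (lpart s t Z) * h t (rpart s t Z)}.
Proof.
move=> s0 t0; have st0 := addr_gt0 s0 t0.
have mD := measurable_Delta L_hausdorff L_locally_compact L_second_countable
  mu Rr Delta hmu s t s0 t0.
have ml : measurable_fun setT (fun Z => h s (@lpart R L s t Z)).
  by apply: (measurableT_comp (mh s s0)); exact: measurable_lpart.
have mr : measurable_fun setT (fun Z => h t (@rpart R L s t Z)).
  by apply: (measurableT_comp (mh t t0)); exact: measurable_rpart.
have moplus : measurable_fun setT (@oplus R L s t) by exact: measurable_oplus.
have : ae_eq (mu (s + t)) setT (EFin \o h (s + t)) (fun Z =>
    (h s (lpart s t Z) * h t (rpart s t Z) * Delta s t (@sigmat R L (s + t) Z))%:E).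
  apply: integral_ae_eq => //.
  - apply/integrableP; split; first by apply/measurable_EFinP; exact: mh.
    under eq_integral do rewrite /= ger0_norm ?h0//.
    by rewrite -hE// probability_setT ltry.
  - apply/measurable_EFinP; apply: measurable_funM => //; exact: measurable_funM.
  - move=> A _ mA; rewrite -hE// nu_conv//.
    rewrite (parts_integral L_hausdorff L_locally_compact L_second_countable mu Rr Delta hmu)//;
      [|exact: mh|exact: mh].
    rewrite /pushforward (product_density _ _ _ _ (mu s) (nu s) (mu t) (nu t) (h s) (h t))//.
    + exact: mh.
    + exact: mh.
    + by move=> B mB; exact: hE.
    + by move=> B mB; exact: hE.
    + by rewrite -[X in measurable X]setTI; exact: moplus.
by apply: filterS => Z /(_ I) [->]; rewrite mulrC mulrA.
Qed.

Lemma density_is_unit : is_unit mu Rr Delta (fun t Z => ((Num.sqrt (h t Z))%:C)%C).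
Proof.
split.
- move=> t t0; split => /=.
  + by apply: (measurableT_comp measurable_sqrt); exact: mh.
  + exact: measurable_cst.
  + apply/integrableP; split.
      apply/measurable_EFinP; apply: measurable_funD => //; apply: measurable_funX.
      by apply: (measurableT_comp measurable_sqrt); exact: mh.
    under eq_integral => Z _.
      rewrite expr0n addr0 sqr_sqrtr ?h0// gee0_abs ?lee_fin ?h0//; over.
    by rewrite -hE// probability_setT ltry.
- move=> A RA; split => /=; first exact: sqrt_density_borel.
  apply: (eq_measurable_fun (cst 0%E)) => // t _.
  by rewrite integral0.
- exists 1 => // ae0.
  (* A section vanishing almost everywhere at time 1 would force [nu 1] to have total mass 0. *)
  suff : nu 1 setT = 0%E by rewrite probability_setT => /eqP; rewrite onee_eq0.
  rewrite hE//; apply/eqP; rewrite eq_le; apply/andP; split; last first.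
    by apply: integral_ge0 => Z _; rewrite lee_fin h0.
  have -> : (\int[mu 1]_(Z in setT) (h 1 Z)%:E = \int[mu 1]_(Z in setT) (cst 0 Z))%E.
    apply: ae_eq_integral => //; first by apply/measurable_EFinP; exact: mh.
    apply: filterS ae0 => Z [/eqP sq0] _ /=; congr EFin.
    by apply/eqP; rewrite eq_le h0 andbT -sqrtr_eq0.
  by rewrite integral0.
- move=> s t s0 t0; have := density_parts s t s0 t0.
  case: (hmu) => _ _ _ _ [_ Dpos _].
  apply: filterS => Z ->; rewrite -!rmorphM/=; congr (_ %:C)%C.
  rewrite !sqrtrM ?mulr_ge0 ?h0 ?ltW ?Dpos//.
Qed.

End unit_of_factorizing.

(** * Normalized squared moduli of a unit form a factorizing family *)

Section factorizing_of_unit.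
Context {R : realType} {L : topologicalType}.
Hypothesis L_hausdorff : hausdorff_space L.
Hypothesis L_locally_compact : locally_compact [set: L].
Hypothesis L_second_countable : @second_countable L.
Context (mu : forall t : R, probability (@Ct R L t) R).
Context (Rr : set (set (@Ct R L 1))) (Delta : R -> R -> @Ct R L 1 -> R).
Hypothesis hmu : measurable_factorizing_family mu Rr Delta.

Let msigmat t (t0 : 0 < t) : measurable_fun setT (@sigmat R L t) :=
  measurable_sigmat L_hausdorff L_locally_compact L_second_countable t t0.
Let munsigmat t (t0 : 0 < t) : measurable_fun setT (@unsigmat R L t) :=
  measurable_unsigmat L_hausdorff L_locally_compact L_second_countable t t0.
Let pos (t : R) : (`]0, +oo[%classic : set R) t -> 0 < t.
Proof. by rewrite /= in_itv/= andbT. Qed.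

Let factorizing (nu : forall t : R, probability (@Ct R L t) R) :=
  [/\ (forall t : R, 0 < t -> nu t `<< mu t),
      (forall s t : R, 0 < s -> 0 < t ->
         forall A : set (@Ct R L (s + t)), measurable A ->
           nu (s + t) A = pushforward (nu s \x nu t)%E (@oplus R L s t) A) &
      (forall A, Rr A ->
         measurable_fun (`]0, +oo[%classic : set R)
           (fun t : R => pushforward (nu t) (@sigmat R L t) A))].

(* In this case the norm of a unit need not be a Borel function of time: when
   [Rr] misses the empty set, the Borel condition on a unit says nothing about
   its value there. The unit is therefore ignored. *)
Lemma factorizing_of_empty_mass : (exists2 t, 0 < t & mu t [set CtT0 t] <> 0%E) ->
  exists nu, factorizing nu.
Proof.
move=> ex.
have pE : forall t, 0 < t -> mu t [set CtT0 t] <> 0%E.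
  apply: additive_never ex => s t s0 t0.
  exact: (empty_null_additive L_hausdorff L_locally_compact L_second_countable
    mu Rr Delta hmu).
exists (fun t => \d_(CtT0 t : @Ct R L t) : probability (@Ct R L t) R); split.
- move=> t t0 N N0 A mA AN; rewrite /= diracE memNset// => A0.
  apply: (pE t t0); apply: N0; first exact: measurable_empty.
  by move=> _ ->; exact: AN.
- move=> s t s0 t0 A mA; rewrite /pushforward.
  have moplus : measurable_fun setT (@oplus R L s t) by exact: measurable_oplus.
  (* The product of the two Dirac masses is the Dirac mass at the pair, since they agree on
     rectangles. *)
  rewrite (@product_measure_unique _ _ _ _ _ _ _
    (\d_((CtT0 s, CtT0 t) : @Ct R L s * @Ct R L t))).
  + rewrite /= !diracE; congr (_%:R%:E); congr nat_of_bool.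
    have o0 : @oplus R L s t (CtT0 s, CtT0 t) = CtT0 (s + t).
      have : ([set CtT0 s] `*` [set CtT0 t]) (CtT0 s : @Ct R L s, CtT0 t : @Ct R L t) by [].
      by rewrite -oplus_preimage_empty//; apply.
    by apply/idP/idP => /set_mem h; apply/mem_set; move: h; rewrite /= o0.
  + move=> B C mB mC; rewrite /= !diracE -EFinM -natrM mulnb; congr (_%:R%:E).
    congr nat_of_bool; apply/idP/andP => [/set_mem[/= ? ?]|[/set_mem ? /set_mem ?]].
      by split; exact: mem_set.
    by apply/mem_set; split.
  + by rewrite -[X in measurable X]setTI; exact: moplus.
- move=> A RA; apply: (eq_measurable_fun (cst (\d_(CtT0 1 : @Ct R L 1) A))) => //.
  move=> t /set_mem /pos t0; rewrite /pushforward /= !diracE; congr (_%:R%:E).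
  have s0 : @sigmat R L t (CtT0 t) = CtT0 1.
    by apply: Ct_inj; rewrite proj1_sigmat//= image_set0.
  by congr nat_of_bool; apply/idP/idP => /set_mem h; apply/mem_set; move: h; rewrite /= s0.
Qed.

(** Transports [borel_field_sqr] from the rescaled measures on C_1 to the measures [mu t], by
    composing with [unsigmat] and [sigmat]. *)
Lemma sqr_coefficient_borel (v : forall t : R, @Ct R L t -> R) :
  (forall t, 0 < t -> measurable_fun setT (v t)) ->
  (forall t, 0 < t -> (mu t).-integrable setT (fun Z => ((v t Z) ^+ 2)%:E)) ->
  (forall A, Rr A -> measurable_fun (`]0, +oo[%classic : set R)
     (fun t : R => (\int[mu t]_(Z in @sigmat R L t @^-1` A) (v t Z)%:E)%E)) ->
  forall A, Rr A -> measurable_fun (`]0, +oo[%classic : set R)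
     (fun t : R => (\int[mu t]_(Z in @sigmat R L t @^-1` A) ((v t Z) ^+ 2)%:E)%E).
Proof.
move=> mv iv2 bv A RA.
have [m mE] := exists_rescaled L_hausdorff L_locally_compact L_second_countable mu.
have [e eE] := exists_ring_sequence mu Rr Delta hmu.
case: (hmu) => _ _ _ [_ _ mR gR bR] _.
have me n : measurable (e n) by apply: mR; rewrite -eE; exists n.
have eI : setI_closed (range e) by rewrite eE; exact: ring_setI mu Rr Delta hmu.
have eg : <<s range e >> = @measurable _ (@Ct R L 1) by rewrite eE.
pose V t W := v t (unsigmat t W).
have mV t : 0 < t -> measurable_fun setT (V t).
  by move=> t0; apply: measurableT_comp; [exact: mv|exact: munsigmat].
have rescale t B (F : @Ct R L 1 -> R) (t0 : 0 < t) :=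
  rescaled_integral L_hausdorff L_locally_compact L_second_countable mu t (m t) B F t0 (mE t t0).
have V2 t B : 0 < t -> measurable B -> (\int[m t]_(W in B) (V t W ^+ 2)%:E =
    \int[mu t]_(Z in @sigmat R L t @^-1` B) ((v t Z) ^+ 2)%:E)%E.
  move=> t0 mB; rewrite rescale//; [|by apply: measurable_funX; exact: mV|by move=> W; exact: sqr_ge0].
  by apply: eq_integral => Z _; rewrite /V sigmatK.
have iV2 t : 0 < t -> (m t).-integrable setT (fun W => (V t W ^+ 2)%:E).
  move=> t0; apply/integrableP; split.
    by apply/measurable_EFinP; apply: measurable_funX; exact: mV.
  under eq_integral do rewrite /= ger0_norm ?sqr_ge0//.
  rewrite V2// preimage_setT; have /integrableP[_] := iv2 t t0.
  by under eq_integral do rewrite /= ger0_norm ?sqr_ge0//.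
have bV : borel_field e (`]0, +oo[%classic : set R) m V.
  move=> n; apply: eq_measurable_fun (bv (e n) _); last by rewrite -eE; exists n.
  move=> t /set_mem /pos t0.
  rewrite (congr1 (fun q => integral q (e n) _) (mE t t0)).
  rewrite (integral_pushforward (msigmat t t0))//.
  - by apply: eq_integral => Z _; rewrite /V /= sigmatK.
  - by apply/measurable_EFinP; exact: mV.
  - rewrite (_ : _ \o _ = EFin \o v t); last by apply/funext => Z /=; rewrite /V sigmatK.
    apply: (integrableS measurableT) => //.
      by rewrite -[X in measurable X]setTI; exact: msigmat.
    by apply: integrable_of_sqr; [exact: mv|exact: iv2].
have b1 : borel_field e (`]0, +oo[%classic : set R) m (fun _ _ => 1).
  move=> n; apply: eq_measurable_fun (bR (e n) _); last by rewrite -eE; exists n.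
  move=> t /set_mem /pos t0.
  rewrite integral_cst// mul1e -(congr1 (fun q => q (e n)) (mE t t0))//.
have [n _ enA] : range e A by rewrite eE.
have := borel_field_sqr e me eI eg _ m V _ _ b1 bV.
move=> /(_ _ _ n); rewrite enA => bs.
apply: (eq_measurable_fun _ _ (bs _ _)) => [t /set_mem /pos t0|t /pos t0|t /pos t0].
- by rewrite V2//; exact: mR.
- exact: mV.
- exact: iV2.
Qed.

(** The squared modulus as a real number, in the form used by the integrability clause of
    [is_unit]. *)
Definition nsq (z : R[i]) : R := complex.Re z ^+ 2 + complex.Im z ^+ 2.

Lemma nsq_ge0 z : 0 <= nsq z. Proof. by rewrite addr_ge0 ?sqr_ge0. Qed.

Lemma nsqM (x y : R[i]) : nsq (x * y) = nsq x * nsq y.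
Proof. by case: x y => [a b] [c d]; rewrite /nsq /=; ring. Qed.

Lemma nsq_eq0 z : nsq z = 0 -> z = 0.
Proof.
case: z => [a b]; rewrite /nsq/= => /eqP.
by rewrite paddr_eq0 ?sqr_ge0// !sqrf_eq0 => /andP[/eqP -> /eqP ->].
Qed.

Context (u : forall t : R, @Ct R L t -> R[i]).
Arguments u : clear implicits.
Hypothesis hu : is_unit mu Rr Delta u.

(** The density of the unnormalized measure attached to [u t]; its total mass [N t] is the squared
    norm of [u t]. *)
Let w t Z := nsq (u t Z).
Let N t : \bar R := (\int[mu t]_Z (w t Z)%:E)%E.

Let mw t : 0 < t -> measurable_fun setT (w t).
Proof.
case: hu => /(_ t) + _ _ _ => /[apply] -[mr mi _].
by apply: measurable_funD; exact: measurable_funX.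
Qed.

Let iw t : 0 < t -> (mu t).-integrable setT (EFin \o w t).
Proof. by case: hu => /(_ t) + _ _ _ => /[apply] -[]. Qed.

Let N_ge0 t : (0 <= N t)%E.
Proof. by apply: integral_ge0 => Z _; rewrite lee_fin nsq_ge0. Qed.

Let N_fin t : 0 < t -> N t \is a fin_num.
Proof. by move=> t0; apply: integrable_fin_num => //; exact: iw. Qed.

Let w_parts s t : 0 < s -> 0 < t -> {ae mu (s + t), forall Z, w (s + t) Z =
  w s (lpart s t Z) * w t (rpart s t Z) * Delta s t (@sigmat R L (s + t) Z)}.
Proof.
move=> s0 t0; case: hu => _ _ _ /(_ s t s0 t0).
case: (hmu) => _ _ _ _ [_ Dpos _].
apply: filterS => Z; rewrite /w => ->; rewrite !nsqM.
rewrite {1}/nsq /= expr0n addr0 sqr_sqrtr ?(ltW (Dpos _ _ _ s0 t0))//.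
by rewrite -mulrA mulrC.
Qed.

(** The whole space as [A] gives multiplicativity of the norm; general [A] gives the factorization
    of [nu]. *)
Let w_integral s t A : 0 < s -> 0 < t -> measurable A ->
  (\int[mu (s + t)%R]_(Z in A) (w (s + t) Z)%:E =
   \int[mu s \x mu t]_(z in oplus s t @^-1` A) (w s z.1 * w t z.2)%:E)%E.
Proof.
move=> s0 t0 mA.
rewrite -(parts_integral L_hausdorff L_locally_compact L_second_countable mu Rr Delta hmu)//;
  [|exact: mw|exact: mw|by move=> Z; exact: nsq_ge0|by move=> Z; exact: nsq_ge0].
have mD := measurable_Delta L_hausdorff L_locally_compact L_second_countable
  mu Rr Delta hmu s t s0 t0.
apply: ae_eq_integral => //.
- by apply: measurable_funTS; apply/measurable_EFinP; apply: mw; exact: addr_gt0.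
- apply: measurable_funTS; apply/measurable_EFinP; apply: measurable_funM => //.
  apply: measurable_funM.
    by apply: (measurableT_comp (mw s s0)); exact: measurable_lpart.
  by apply: (measurableT_comp (mw t t0)); exact: measurable_rpart.
- by apply: filterS (w_parts s t s0 t0) => Z -> _.
Qed.

Let ND s t : 0 < s -> 0 < t -> N (s + t) = (N s * N t)%E.
Proof.
move=> s0 t0; rewrite /N w_integral// preimage_setT -setXTT.
by rewrite ge0_integral_prod_rect//; [exact: mw|exact: mw|move=> Z; exact: nsq_ge0..].
Qed.

(** A unit is only known to be nonzero at one time. As the norm is multiplicative, [additive_never]
    spreads this to all times, which makes the normalization possible. *)
Let N_neq0 t : 0 < t -> N t <> 0%E.
Proof.
move: t; apply: (additive_never (fun t => N t = 0%E)).
  move=> s t s0 t0; rewrite ND//; split=> [/eqP|[]->]; rewrite ?mul0e ?mule0//.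
  by rewrite mule_eq0 => /orP[]/eqP; [left|right].
case: hu => _ _ [t t0 une0] _; exists t => // Nt0; apply: une0.
have : (\int[mu t]_(Z in setT) `|(w t Z)%:E| = 0)%E.
  by rewrite -[RHS]Nt0; apply: eq_integral => Z _; rewrite gee0_abs// lee_fin nsq_ge0.
move=> /ae_eq_integral_abs; have mE : measurable_fun setT (EFin \o w t).
  by apply/measurable_EFinP; exact: mw.
move=> /(_ measurableT mE); apply: filterS => Z /(_ I) /= [].
exact: nsq_eq0.
Qed.

Let r t := fine (N t).

Let r_gt0 t : 0 < t -> 0 < r t.
Proof.
move=> t0; rewrite fine_gt0// lt_neqAle N_ge0 andbT ltey_eq N_fin//= eq_sym andbT.
by apply/eqP; exact: N_neq0.
Qed.

Let rE t : 0 < t -> N t = (r t)%:E. Proof. by move=> t0; rewrite fineK// N_fin. Qed.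

(** Real and imaginary parts are treated separately; the square of each is dominated by [w t], hence
    integrable. *)
Let mass_borel (A : set (@Ct R L 1)) : Rr A ->
  measurable_fun (`]0, +oo[%classic : set R)
    (fun t : R => (\int[mu t]_(Z in @sigmat R L t @^-1` A) (w t Z)%:E)%E).
Proof.
move=> RA; case: (hu) => meas coef _ _.
have [mR iR] : (forall t, 0 < t -> measurable_fun setT (fun Z => complex.Re (u t Z))) /\
    (forall t, 0 < t -> measurable_fun setT (fun Z => complex.Im (u t Z))).
  by split=> t /meas[].
have iR2 t : 0 < t -> (mu t).-integrable setT (fun Z => (complex.Re (u t Z) ^+ 2)%:E).
  move=> t0; apply: le_integrable (iw t t0) => //.
    by apply/measurable_EFinP; apply: measurable_funX; exact: mR.
  move=> Z _; rewrite /= lee_fin !ger0_norm ?nsq_ge0 ?sqr_ge0//.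
  by rewrite lerDl sqr_ge0.
have iI2 t : 0 < t -> (mu t).-integrable setT (fun Z => (complex.Im (u t Z) ^+ 2)%:E).
  move=> t0; apply: le_integrable (iw t t0) => //.
    by apply/measurable_EFinP; apply: measurable_funX; exact: iR.
  move=> Z _; rewrite /= lee_fin !ger0_norm ?nsq_ge0 ?sqr_ge0//.
  by rewrite lerDr sqr_ge0.
have bR := sqr_coefficient_borel (fun t Z => complex.Re (u t Z)) mR iR2
  (fun A RA => (coef A RA).1) A RA.
have bI := sqr_coefficient_borel (fun t Z => complex.Im (u t Z)) iR iI2
  (fun A RA => (coef A RA).2) A RA.
apply: eq_measurable_fun (emeasurable_funD bR bI) => t /set_mem /pos t0.
have msA : measurable (@sigmat R L t @^-1` A).
  rewrite -[X in measurable X]setTI; apply: msigmat => //.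
  by case: (hmu) => _ _ _ [_ _ RM _ _] _; exact: RM.
rewrite -ge0_integralD//.
- by move=> Z _; rewrite lee_fin sqr_ge0.
- by apply/measurable_EFinP; apply: measurable_funTS; apply: measurable_funX; exact: mR.
- by move=> Z _; rewrite lee_fin sqr_ge0.
- by apply/measurable_EFinP; apply: measurable_funTS; apply: measurable_funX; exact: iR.
Qed.

Hypothesis empty0 : forall t, 0 < t -> mu t [set CtT0 t] = 0%E.

(** Normalizing by [N] turns [w_integral] into the convolution identity. For the Borel condition [N]
    must itself be Borel, and it is the limit of its Borel contributions from an increasing sequence
    of sets of the ring. *)
Lemma factorizing_of_unit : exists nu, factorizing nu.
Proof.
pose f t Z := w t Z / r t.
have mf t : 0 < t -> measurable_fun setT (f t).
  by move=> t0; apply: measurable_funM => //; exact: mw.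
have f0 t Z : 0 <= f t Z by rewrite divr_ge0 ?nsq_ge0// fine_ge0.
have fE t B : 0 < t -> measurable B -> (\int[mu t]_(Z in B) (f t Z)%:E =
    (\int[mu t]_(Z in B) (w t Z)%:E) * ((r t)^-1)%:E)%E.
  move=> t0 mB; rewrite -ge0_integralZr//.
  - by apply/measurable_EFinP; apply: measurable_funTS; exact: mw.
  - by move=> Z _; rewrite lee_fin nsq_ge0.
  - by rewrite lee_fin invr_ge0 fine_ge0.
have f1 t : 0 < t -> (\int[mu t]_Z (f t Z)%:E = 1)%E.
  by move=> t0; rewrite fE// -/(N t) rE// -EFinM divff// gt_eqF// r_gt0.
have ex t : exists n : probability (@Ct R L t) R, 0 < t ->
    n = (fun A => \int[mu t]_(Z in A) (f t Z)%:E)%E :> (set _ -> \bar R).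
  have [t0|t0] := boolP (0 < t); last by exists (mu t).
  have [n nE] := density_probability _ _ (mu t) (f t) (mf t t0) (f0 t) (f1 t t0).
  by exists n.
pose nu t := sval (cid (ex t)).
have nuE t B : 0 < t -> nu t B = (\int[mu t]_(Z in B) (f t Z)%:E)%E.
  by move=> t0; exact: (congr1 (fun q => q B) (svalP (cid (ex t)) t0)).
exists nu; split.
- move=> t t0; apply: (density_dominates _ _ _ _ (f t)); first exact: mf.
  by move=> A _; exact: nuE.
- move=> s t s0 t0 A mA; have st0 := addr_gt0 s0 t0.
  have moplus : measurable_fun setT (@oplus R L s t) by exact: measurable_oplus.
  have mA' : measurable (@oplus R L s t @^-1` A).
    by rewrite -[X in measurable X]setTI; exact: moplus.
  rewrite nuE// fE// w_integral// /pushforward.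
  rewrite (product_density _ _ _ _ (mu s) (nu s) (mu t) (nu t) (f s) (f t))//;
    [|exact: mf|exact: mf|by move=> B _; exact: nuE|by move=> B _; exact: nuE].
  rewrite -ge0_integralZr//.
  + apply: eq_integral => z _; rewrite -EFinM /f; congr EFin.
    have -> : r (s + t) = r s * r t by rewrite /r ND// fineM// N_fin.
    by rewrite invfM mulrACA.
  + apply: measurable_funTS; apply/measurable_EFinP; apply: measurable_funM.
      by apply: (measurableT_comp (mw s s0)).
    by apply: (measurableT_comp (mw t t0)).
  + by move=> z _; rewrite lee_fin mulr_ge0 ?nsq_ge0.
  + by rewrite lee_fin invr_ge0 fine_ge0.
- case: (hmu) => _ _ _ [_ _ RM _ _] _.
  have msig t B : 0 < t -> measurable B -> measurable (@sigmat R L t @^-1` B).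
    by move=> t0 mB; rewrite -[X in measurable X]setTI; exact: msigmat.
  have [E [RE ndE UE]] := exists_ring_exhaustion mu Rr Delta hmu.
  have Ncvg t : 0 < t ->
      (\int[mu t]_(Z in @sigmat R L t @^-1` E n) (w t Z)%:E @[n --> \oo] --> N t)%E.
    move=> t0; have mEt n : measurable (@sigmat R L t @^-1` E n).
      by apply: msig => //; exact: RM.
    have mU : measurable (\bigcup_n (@sigmat R L t @^-1` E n)).
      by apply: bigcup_measurable => n _; exact: mEt.
    (* The part of C_1 not covered by the ring is null since the empty set has mass 0, so the
       exhausting sequence carries all of [nu t]; continuity from below then gives the limit. *)
    have nuU : nu t (\bigcup_n (@sigmat R L t @^-1` E n)) = 1%E.
      rewrite -preimage_bigcup UE -[X in nu t X]setCK probability_setC; last first.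
        by apply: measurableC; rewrite -UE preimage_bigcup.
      have mC : measurable (@sigmat R L t @^-1` (~` \bigcup_(A in Rr) A)).
        by rewrite -preimage_setC; apply: measurableC; rewrite -UE preimage_bigcup.
      rewrite preimage_setC nuE// null_set_integral ?sube0//.
        by apply/measurable_EFinP; apply: measurable_funTS; exact: mf.
      apply: (uncovered_null L_hausdorff L_locally_compact L_second_countable
        mu Rr Delta hmu) => //; exact: empty0.
    have nd : {homo (fun n => @sigmat R L t @^-1` E n) : a b / (a <= b)%N >-> (a <= b)%O}.
      by move=> a b ab; apply/subsetPset; apply: preimage_subset; exact/subsetPset/ndE.
    have cv : (nu t (@sigmat R L t @^-1` E n) @[n --> \oo] --> 1)%E.
      by rewrite -nuU; exact: (@nondecreasing_cvg_mu _ _ _ (nu t) _ mEt mU nd).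
    rewrite rE// -[X in _ --> X]mule1.
    rewrite [X in X @ _ --> _](_ : _ = fun n => ((r t)%:E * nu t (@sigmat R L t @^-1` E n))%E).
      by apply: cvgeZl.
    by apply/funext=> n; rewrite nuE// fE// muleCA -EFinM divff ?mule1// gt_eqF ?r_gt0.
  have bN : measurable_fun (`]0, +oo[%classic : set R) N.
    apply: (emeasurable_fun_cvg (fun n t =>
      (\int[mu t]_(Z in @sigmat R L t @^-1` E n) (w t Z)%:E)%E)).
      by move=> n; exact: mass_borel.
    by move=> t /pos t0; exact: Ncvg.
  move=> A RA.
  apply: (eq_measurable_fun (fun t : R =>
    (\int[mu t]_(Z in @sigmat R L t @^-1` A) (w t Z)%:E) * ((r t)^-1)%:E)%E).
    move=> t /set_mem /pos t0; rewrite /pushforward nuE// fE//.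
    by apply: msig => //; exact: RM.
  apply: emeasurable_funM; first exact: mass_borel.
  apply/measurable_EFinP; apply: measurable_inv_ge0.
    exact: (measurableT_comp (@fine_measurable R setT measurableT)).
  by move=> t _; rewrite fine_ge0.
Qed.

End factorizing_of_unit.

Theorem theorem3p2 (R : realType) (L : topologicalType)
  (L_hausdorff : hausdorff_space L)
  (L_locally_compact : locally_compact [set: L])
  (L_second_countable : @second_countable L)
  (mu : forall t : R, probability (@Ct R L t) R)
  (Rr : set (set (@Ct R L 1)))
  (Delta : R -> R -> @Ct R L 1 -> R)
  (hmu : measurable_factorizing_family mu Rr Delta) :
  spatial mu Rr Delta <->
  exists nu : forall t : R, probability (@Ct R L t) R,
    [/\ (forall t : R, 0 < t -> nu t `<< mu t),
        (forall s t : R, 0 < s -> 0 < t ->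
           forall A : set (@Ct R L (s + t)), measurable A ->
             nu (s + t) A = pushforward (nu s \x nu t)%E (@oplus R L s t) A) &
        (forall A, Rr A ->
           measurable_fun (`]0, +oo[%classic : set R)
             (fun t : R => pushforward (nu t) (@sigmat R L t) A))].
Proof.
split=> [[u hu]|[nu [numu nu_conv nu_borel]]].
  (* If the empty set has positive mass at some time, the Dirac masses serve; otherwise its mass
     vanishes at every positive time, as the normalization argument requires. *)
  have [ex|nex] := pselect (exists2 t, 0 < t & mu t [set CtT0 t] <> 0%E).
    exact: factorizing_of_empty_mass hmu ex.
  apply: (factorizing_of_unit L_hausdorff L_locally_compact L_second_countable
    mu Rr Delta hmu u hu) => t t0.
  by apply: contrapT => ne; apply: nex; exists t.
have ex t : exists h : @Ct R L t -> R, [/\ 0 < t -> measurable_fun setT h,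
    (forall Z, 0 <= h Z) & (0 < t -> forall A, measurable A ->
    nu t A = (\int[mu t]_(Z in A) (h Z)%:E)%E)].
  (* At nonpositive times the density is set to 0, so that it is nonnegative for every [t]. *)
  have [t0|t0] := boolP (0 < t); last by exists (cst 0); split=> //; rewrite (negPf t0).
  by have [h [mh h0 hE]] := exists_density _ _ _ _ (numu t t0); exists h.
pose h t := sval (cid (ex t)).
have hP t := svalP (cid (ex t)).
exists (fun t Z => ((Num.sqrt (h t Z))%:C)%C).
apply: (density_is_unit L_hausdorff L_locally_compact L_second_countable
  mu Rr Delta hmu nu h) => //.
- by move=> t t0; have [+ _ _] := hP t; apply.
- by move=> t Z; have [_ + _] := hP t; apply.
- by move=> t A t0 mA; have [_ _] := hP t; apply.
Qed.
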